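(* Let $p\in(0,1)$ be a constant. There exist constants $c_1=c_1(p)>0$ and $c_2=c_2(p)>0$ such that, with probability tending to $1$ as $n\to\infty$, $$\frac{c_1 n^2}{(\ln n)^2}\le \theta_1(G_{n,p})\le \frac{c_2 n^2}{(\ln n)^2}.$$
   Context: For a graph $G$, the clique cover number $\theta_1(G)$ is the minimum number of cliques (complete subgraphs of $G$) required to cover all the edges of $G$, i.e. such that every edge of $G$ lies in at least one of the cliques. The random graph $G_{n,p}$ has $n$ vertices, and each of the $\binom n2$ possible edges occurs independently with probability $p$. *)

(* Defs.v *)
From HB Require Import structures.
From mathcomp Require Import all_boot all_order all_algebra.

Set Implicit Arguments.
Unset Strict Implicit.
Unset Printing Implicit Defensive.

Import GRing.Theory.
Local Open Scope ring_scope.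

Definition vpairs (V : finType) : {set {set V}} :=
  [set e : {set V} | #|e| == 2%N].

Record sgraph (V : finType) : Type :=
  SGraph { edges : {set {set V}}; _ : edges \subset vpairs V }.

HB.instance Definition _ (V : finType) := [isSub for @edges V].
HB.instance Definition _ (V : finType) := [Countable of sgraph V by <:].
HB.instance Definition _ (V : finType) := [Finite of sgraph V by <:].

Section CliqueCover.
Variable V : finType.
Implicit Types (G : sgraph V) (K : {set V}) (C : {set {set V}}).

Definition is_clique G K : bool :=
  [forall u in K, forall v in K, (u != v) ==> ([set u; v] \in edges G)].

Definition is_clique_cover G C : bool :=
  [forall K in C, is_clique G K]
  && [forall e in edges G, exists K in C, e \subset K].

(* The edge set itself is a clique cover, so it can serve as the starting
   point of the arg min (see theta1P). *)
Definition theta1 G : nat :=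
  #|[arg min_(C < edges G | is_clique_cover G C) #|C| ]|.

Lemma edges_clique_cover G : is_clique_cover G (edges G).
Proof.
apply/andP; split; last first.
  by apply/forall_inP => e eG; apply/exists_inP; exists e.
apply/forall_inP => e eG.
have /subsetP/(_ e eG) : edges G \subset vpairs V by apply: (valP G).
rewrite inE => /cards2P [x [y [xy eE]]].
apply/forall_inP => u uK; apply/forall_inP => v vK; apply/implyP => uv.
suff -> : [set u; v] = e by [].
move: uK vK uv; rewrite eE !inE.
move=> /orP[] /eqP-> /orP[] /eqP->; rewrite ?eqxx //.
by rewrite setUC.
Qed.

Lemma theta1P G :
  (exists2 C, is_clique_cover G C & #|C| = theta1 G) /\
  (forall C, is_clique_cover G C -> (theta1 G <= #|C|)%N).
Proof.
rewrite /theta1; case: arg_minnP; first exact: edges_clique_cover.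
by move=> C CG Cmin; split => //; exists C.
Qed.

End CliqueCover.

Section RandomGraph.
Variable R : comNzRingType.
Implicit Type p : R.

Definition Gnp_mass (n : nat) p (G : sgraph 'I_n) : R :=
  \prod_(e in vpairs 'I_n) (if e \in edges G then p else 1 - p).

Definition Gnp_prob (n : nat) p (A : pred (sgraph 'I_n)) : R :=
  \sum_(G | A G) Gnp_mass p G.

(* Mutual independence of the edges: any prescribed set S of pairs is
   contained in the random graph with probability p ^+ #|S|. *)
Lemma Gnp_prob_edges n p (S : {set {set 'I_n}}) : S \subset vpairs 'I_n ->
  Gnp_prob p (fun G => S \subset edges G) = p ^+ #|S|.
Proof.
move=> SV; pose P := vpairs 'I_n.
pose F e : R := if e \in P then p else 0.
pose H e : R := if e \in S then 0 else if e \in P then 1 - p else 1.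
have -> : p ^+ #|S| = \prod_(e : {set 'I_n}) (F e + H e).
  rewrite (bigID (mem S)) /= [X in _ * X]big1 ?mulr1; last first.
    move=> e /negbTE eS; rewrite /F /H eS.
    by case: ifP => _; rewrite ?add0r // addrC subrK.
  rewrite (eq_bigr (fun=> p)) ?prodr_const // => e eS.
  by rewrite /F /H eS (subsetP SV) // addr0.
rewrite bigA_distr.
rewrite (bigID (fun J : {set {set 'I_n}} => (J \subset P) && (S \subset J))) /=.
rewrite [X in _ + X]big1 ?addr0; last first.
  move=> J; rewrite negb_and => /orP[] /subsetPn[e eJ eN];
    rewrite (bigD1 e) //= ?eJ ?(negbTE eN) /F /H ?eJ ?(negbTE eN) mul0r //.
rewrite (reindex_omap (@edges 'I_n) insub) /=; last first.
  by move=> J /andP[JP _]; rewrite insubT.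
apply: eq_big => [G|G SG].
  have GP : edges G \subset P by apply: (valP G).
  by rewrite GP valK eqxx andbT.
have GP : edges G \subset P by apply: (valP G).
rewrite /Gnp_mass [RHS](bigID (mem P)) /= [X in _ * X]big1 ?mulr1.
  apply: eq_bigr => e eP; rewrite /F /H eP; case: ifP => // /negbT eG.
  by rewrite (negbTE (contra (subsetP SG e) eG)).
move=> e eP; rewrite /F /H (negbTE eP).
rewrite (negbTE (contra (subsetP GP e) eP)).
by rewrite (negbTE (contra (subsetP SV e) eP)).
Qed.

Lemma Gnp_probT n p : Gnp_prob p (fun _ : sgraph 'I_n => true) = 1.
Proof.
rewrite -(expr0 p) -(@cards0 {set 'I_n}) -Gnp_prob_edges ?sub0set //.
by apply: eq_bigl => G; rewrite sub0set.
Qed.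

End RandomGraph.

(* Main.v *)
Require Import Defs.
From mathcomp Require Import reals sequences exp.
From mathcomp Require Import all_boot all_order all_algebra.
From mathcomp Require Import ring lra zify.
Set Implicit Arguments.
Unset Strict Implicit.
Unset Printing Implicit Defensive.
Import Order.TTheory GRing.Theory Num.Theory.
Local Open Scope ring_scope.

(** Cliques of G(n,p) have O(ln n) vertices with high probability, so each of
    them covers O(ln^2 n) of the roughly p n^2 / 2 edges: this is the lower
    bound (Ex_cliques_le, card_edges_le).

    For the upper bound, write E_q for the expectation over G(n,q).  The idea is
    to lower the density q from p down to 1 / ln^2 n in small steps, each of
    which costs O(1) cliques.  Plant a clique on a uniformly random k-set of
    G(n,q'), where 1 - q = (1 - q') (1 - kappa) and kappa is the probability
    that a given pair lies in the k-set; every pair then becomes an edge with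
    probability exactly q.  Planting one clique raises the cover number by at
    most 1, so it suffices that the planted graph and G(n,q) give nearly the
    same expected cover number.  For any functional g the difference of the two
    expectations is at most the square root of chi^2 * Var_q g
    (Ex_mixture_ge).  Since the single-edge marginals agree, the contributions
    to chi^2 of k-sets meeting in at most two vertices cancel to first order,
    and those meeting in three or more vertices give n^(-3 + o(1)) as long as k
    is a small multiple of ln n / ln (1/q) (sum_overlap_exp,
    chi_planted_avg).  The variance is n^(2 + o(1)) whenever g is Lipschitz
    with an n^(o(1)) constant in each edge (Var_lipschitz), and then
    E_q g <= E_q' g + O(1) (planting_step).

    The cover number itself need not be Lipschitz, because deleting an edge
    spoils every clique that contains it.  It is replaced by a larger
    quantity, capped_cover, that only uses families of cliques of size at most
    l containing every pair at most l^6 times and pays 1 for each edge left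
    uncovered.

    One step lowers q by about (1 - q) k^2 / n^2.  With
    k = q^(1/4) ln n / 240 the function sqrt q drops by a fixed multiple of
    ln^2 n / n^2 at each step, so O(n^2 / ln^2 n) steps suffice; at density
    1 / ln^2 n the edges can be covered one by one.  This bounds the
    expectation of capped_cover by O(n^2 / ln^2 n) (Ex_capped_cover_le), and
    the same variance bound with Chebyshev's inequality turns it into a bound
    with high probability. *)

(** * Elementary estimates *)

Lemma set_ind (T : finType) (Q : {set T} -> Prop) :
  Q set0 -> (forall (a : T) (A : {set T}), a \notin A -> Q A -> Q (a |: A)) ->
  forall A, Q A.
Proof.
move=> Q0 QU A; elim: {A}_.+1 {-2}A (ltnSn #|A|) => // n IHn A.
have [->//|/set0Pn[a aA]] := eqVneq A set0.
rewrite (cardsD1 a) aA ltnS => /IHn QA.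
by rewrite -(setD1K aA); apply: QU QA; rewrite !inE eqxx.
Qed.

Lemma prod_if_in (R : comPzSemiRingType) (T : finType) (P S : {set T}) (c : R) :
  S \subset P ->
  \prod_(e in P) (if e \in S then c else 1) = c ^+ #|S|.
Proof.
move=> sSP; rewrite -big_mkcondr /= -prodr_const; apply: eq_bigl => e.
by apply/andP/idP => [[]//|eS]; split=> //; apply: (subsetP sSP).
Qed.

Lemma card_bigcup_le (I T : finType) (F : {set I}) (B : I -> {set T}) :
  (#|\bigcup_(i in F) B i| <= \sum_(i in F) #|B i|)%N.
Proof.
elim/big_rec2: _ => [|i m S _ IH]; first by rewrite cards0.
by rewrite (leq_trans (leq_card_setU _ _)) // leq_add2l.
Qed.

Lemma bin2_le j k : (j <= k)%N -> ('C(j, 2) <= j * k)%N.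
Proof.
move=> jk; rewrite bin2 leq_half_double -addnn.
apply: leq_trans (leqW (leq_addl _ _)).
by rewrite leq_mul2l (leq_trans (leq_pred j) jk) orbT.
Qed.

Lemma binS2_le (R : realFieldType) (m : nat) : 'C(m, 2)%:R <= m%:R ^+ 2 :> R.
Proof. by rewrite -natrX ler_nat (leq_trans (bin2_le (leqnn m))) // mulnn. Qed.

Lemma bin2_natr (R : realFieldType) (m : nat) :
  'C(m, 2)%:R = m%:R * (m%:R - 1) / 2 :> R.
Proof.
case: m => [|m]; first by rewrite bin0n mul0r mul0r.
have := mul_bin_diag m.+1 1; rewrite /= bin1 => /(congr1 (fun i => i%:R : R)).
rewrite !natrM => H; rewrite (_ : m.+1%:R - 1 = m%:R).
  by rewrite H mulrC mulKf // pnatr_eq0.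
by rewrite -[m.+1]addn1 natrD addrK.
Qed.

Lemma bin_sub_le n k j : (j <= k <= n)%N ->
  ('C(n - j, k - j) * n ^ j <= 'C(n, k) * k ^ j)%N.
Proof.
elim: j => [|j IH] /andP[jk kn]; first by rewrite !subn0 !expn0.
have {}IH := IH _; rewrite -(@leq_pmul2l (n - j)); last by lia.
have := mul_bin_diag (n - j).-1.+1 (k - j.+1).
rewrite !prednK; try lia; rewrite (_ : (k - j.+1).+1 = k - j)%N; last by lia.
rewrite (_ : (n - j).-1 = n - j.+1)%N; last by lia.
move=> E; rewrite mulnA E.
have H1 : ('C(n - j, k - j) * n ^ j <= 'C(n, k) * k ^ j)%N by apply: IH; lia.
have H2 : ((k - j) * n <= (n - j) * k)%N.
  by rewrite !mulnBl (mulnC k n) leq_sub2l // leq_mul2l kn orbT.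
have := leq_mul H2 H1; rewrite !expnS; congr (_ <= _)%N; ring.
Qed.

Lemma bin_sub2 n k : (2 <= k <= n)%N ->
  ('C(n - 2, k - 2) * 'C(n, 2) = 'C(n, k) * 'C(k, 2))%N.
Proof.
case: n k => [|[|n]] [|[|k]] // _; rewrite !subSS !subn0.
have := mul_bin_diag n.+2 k.+1; have := mul_bin_diag n.+1 k; rewrite /= => E1 E2.
have b2 i : ('C(i.+2, 2) * 2 = i.+2 * i.+1)%N.
  by have := mul_bin_diag i.+2 1; rewrite /= bin1 => ->; exact: mulnC.
apply/eqP; rewrite -(@eqn_pmul2r 2) // -!mulnA !b2.
rewrite (mulnC 'C(n, k)) -mulnA E1 (mulnCA _ k.+1) E2.
by rewrite mulnA (mulnC k.+1) [X in _ == X]mulnC.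
Qed.

Lemma card_vpairs (V : finType) : #|vpairs V| = 'C(#|V|, 2).
Proof. by rewrite -card_draws. Qed.

Lemma expR_le1D2 (R : realType) (z : R) : 0 <= z <= 2^-1 -> expR z <= 1 + 2 * z.
Proof.
move=> /andP[z0 z1]; have := expR_ge1Dx (- z); rewrite expRN => H.
have e0 : 0 < expR z by apply: expR_gt0.
have : expR z * (1 - z) <= 1.
  by rewrite -[leRHS](divff (lt0r_neq0 e0)) ler_wpM2l // ltW.
nra.
Qed.

Lemma inv_le_expR (R : realType) (s : R) : 0 < s -> 2 / s ^+ 4 <= expR (6 / s).
Proof.
move=> s0; have -> : 6 / s = 4%:R * ((3 / 2) / s) by field; rewrite gt_eqF.
rewrite expRM_natl; apply: le_trans (_ : ((3 / 2) / s) ^+ 4 <= _).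
  rewrite expr_div_n ler_wpM2r ?invr_ge0 ?exprn_ge0 ?(ltW s0) //; lra.
apply: lerXn2r; rewrite ?nnegrE ?expR_ge0 ?divr_ge0 ?(ltW s0) //.
by apply: le_trans (expR_ge1Dx _); rewrite lerDr.
Qed.

Lemma exp_frac_ge (R : realType) (L : R) :
  0 < L -> 480 ^+ 2 <= L -> L <= expR (L / 40).
Proof.
move=> L0 Lbig; apply: le_trans (_ : 1 + (L / 40) ^+ 2 / 2 <= _); last first.
  by apply: (expR_ge1Dxn 1); rewrite divr_ge0 // ltW.
have : 480 ^+ 2 * L <= L * L by rewrite ler_wpM2r // ltW.
by rewrite expr2; lra.
Qed.

(** * Expectation and variance over a random subset *)

Section RandomSubset.
Variables (R : realFieldType) (T : finType).
Implicit Types (r : T -> R) (P A S : {set T}) (g h : {set T} -> R).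

Definition bern P r A : R := \prod_(e in P) (if e \in A then r e else 1 - r e).

Definition Ex P r g : R := \sum_(A : {set T} | A \subset P) bern P r A * g A.

Lemma Ex_set0 r g : Ex set0 r g = g set0.
Proof.
rewrite /Ex (big_pred1 set0) => [|A]; last by rewrite subset0.
by rewrite /bern big_set0 mul1r.
Qed.

Lemma ExU1 a P r g : a \notin P ->
  Ex (a |: P) r g =
  r a * Ex P r (fun A => g (a |: A)) + (1 - r a) * Ex P r g.
Proof.
move=> aP; rewrite /Ex (bigID (fun A : {set T} => a \in A)) /=; congr (_ + _).
  rewrite mulr_sumr (reindex_onto (fun A => a |: A) (fun A => A :\ a)) /=;
    last by move=> A /andP[_ aA]; rewrite setD1K.
  have E A : (a |: A \subset a |: P) && (a \in a |: A) && ((a |: A) :\ a == A)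
             = (A \subset P).
    rewrite setU11 andbT; apply/andP/idP => [[/subsetP sAP /eqP EA]|sAP].
      apply/subsetP => x xA; have: x \in (a |: A) :\ a by rewrite EA.
      rewrite !inE => /andP[/negbTE xa _]; have := sAP x.
      by rewrite !inE xA orbT xa => /(_ isT).
    rewrite setUS // setU1K //; apply: contra aP; exact: (subsetP sAP).
  rewrite (eq_bigl _ _ E); apply: eq_bigr => A sAP.
  rewrite mulrA; congr (_ * _); rewrite /bern big_setU1 //= setU11.
  congr (_ * _); apply: eq_bigr => e eP; rewrite !inE.
  by case: eqVneq => // ea; rewrite ea (negbTE aP) in eP.
rewrite mulr_sumr; apply: eq_big => [A|A /andP[_ aA]].
  apply/andP/idP => [[/subsetP sAP aA]|sAP].
    apply/subsetP => x xA; have := sAP x xA; rewrite !inE => /orP[/eqP xa|//].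
    by rewrite -xa xA in aA.
  split; first exact: subset_trans sAP (subsetUr _ _).
  by apply: contra aP; exact: (subsetP sAP).
rewrite mulrA; congr (_ * _); rewrite /bern big_setU1 //= (negbTE aA).
by congr (_ * _).
Qed.

Lemma eq_Ex P r g h : (forall A, A \subset P -> g A = h A) ->
  Ex P r g = Ex P r h.
Proof. by move=> gh; apply: eq_bigr => A sAP; rewrite gh. Qed.

Lemma ExD P r g h : Ex P r (fun A => g A + h A) = Ex P r g + Ex P r h.
Proof. by rewrite -big_split; apply: eq_bigr => A _; rewrite mulrDr. Qed.

Lemma ExZ P r c g : Ex P r (fun A => c * g A) = c * Ex P r g.
Proof. by rewrite mulr_sumr; apply: eq_bigr => A _; rewrite mulrCA. Qed.

Lemma Ex_sum (I : finType) (Q : pred I) P r (G : I -> {set T} -> R) :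
  Ex P r (fun A => \sum_(i | Q i) G i A) = \sum_(i | Q i) Ex P r (G i).
Proof.
by rewrite exchange_big; apply: eq_bigr => A _; rewrite mulr_sumr.
Qed.

Lemma Ex_cst P r c : Ex P r (fun=> c) = c.
Proof.
elim/set_ind: P => [|a P aP IH]; first by rewrite Ex_set0.
by rewrite ExU1 // IH -mulrDl addrC subrK mul1r.
Qed.

Lemma bern_ge0 P r A : (forall e, 0 <= r e <= 1) -> 0 <= bern P r A.
Proof.
move=> r01; apply: prodr_ge0 => e _; have /andP[r0 r1] := r01 e.
by case: ifP => // _; rewrite subr_ge0.
Qed.

Lemma ler_Ex P r g h : (forall e, 0 <= r e <= 1) ->
  (forall A, A \subset P -> g A <= h A) -> Ex P r g <= Ex P r h.
Proof.
by move=> r01 gh; apply: ler_sum => A sAP; rewrite ler_wpM2l ?gh ?bern_ge0.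
Qed.

Lemma Ex_prod P r (a b : T -> R) :
  Ex P r (fun A => \prod_(e in P) (if e \in A then a e else b e)) =
  \prod_(e in P) (r e * a e + (1 - r e) * b e).
Proof.
elim/set_ind: P => [|x P xP IH]; first by rewrite Ex_set0 !big_set0.
rewrite ExU1 // big_setU1 //= -IH [RHS]mulrDl -!mulrA -(ExZ _ _ (a x)) -(ExZ _ _ (b x)).
congr (_ * _ + _ * _); apply: eq_Ex => A sAP; rewrite big_setU1 //= ?setU11.
  congr (_ * _); apply: eq_bigr => e eP; rewrite !inE.
  by case: eqVneq => // ea; rewrite ea (negbTE xP) in eP.
by rewrite (negbTE (contra (subsetP sAP x) xP)).
Qed.

(** Adding S to the random set is the same as raising the rates on S to 1; this
    is how a planted clique becomes a product law. *)
Lemma Ex_setU P S (q : R) g : S \subset P ->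
  Ex P (fun=> q) (fun A => g (A :|: S)) =
  Ex P (fun e => if e \in S then 1 else q) g.
Proof.
move=> sSP; rewrite -[in LHS](setIidPl sSP) {sSP}.
elim/set_ind: P g => [|a P aP IH] g; first by rewrite !Ex_set0 setI0 setU0.
rewrite !ExU1 // -!IH; case: ifPn => aS.
  rewrite subrr mul0r addr0 mul1r.
  have EI : S :&: (a |: P) = a |: (S :&: P).
    by rewrite setIUr (setIidPr _) ?sub1set.
  rewrite EI; under eq_Ex do rewrite setUACA setUid.
  under [X in _ + _ * X]eq_Ex do rewrite setUCA.
  by rewrite -mulrDl addrC subrK mul1r; apply: eq_Ex => A _; rewrite setUCA.
have EI : S :&: (a |: P) = S :&: P.
  apply/setP => x; rewrite !inE.
  by case: eqVneq => [->|_]; rewrite ?(negbTE aS).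
by rewrite EI; congr (_ * _ + _); apply: eq_Ex => A _; rewrite setUA.
Qed.

Lemma Ex_card P r : Ex P r (fun A => #|A|%:R) = \sum_(e in P) r e.
Proof.
elim/set_ind: P => [|a P aP IH]; first by rewrite Ex_set0 big_set0 cards0.
rewrite ExU1 // big_setU1 //= IH.
rewrite (@eq_Ex _ _ _ (fun A => 1 + #|A|%:R)) ?ExD ?Ex_cst ?IH; last first.
  by move=> A sAP; rewrite cardsU1 (contra (subsetP sAP a) aP) natrD.
by ring.
Qed.

Definition Var P r g : R := Ex P r (fun A => (g A - Ex P r g) ^+ 2).

Lemma VarE P r g : Var P r g = Ex P r (fun A => g A ^+ 2) - Ex P r g ^+ 2.
Proof.
rewrite /Var; set m := Ex P r g.
rewrite (@eq_Ex P r _ (fun A => g A ^+ 2 + (- (2 * m) * g A + m ^+ 2)));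
  last by move=> A _; ring.
by rewrite !ExD ExZ Ex_cst -/m; ring.
Qed.

(** A weak form of the Efron-Stein inequality: revealing one more element adds
    to the variance at most the variance of a two-point distribution of
    diameter c. *)
Lemma Var_lipschitz P r g (c : R) : (forall e, 0 <= r e <= 1) ->
  (forall a A, a \in P -> A \subset P -> `|g (a |: A) - g A| <= c) ->
  Var P r g <= #|P|%:R * c ^+ 2.
Proof.
move=> r01; elim/set_ind: P g => [|a P aP IH] g gc.
  by rewrite VarE !Ex_set0 subrr cards0 mul0r.
have sP : P \subset a |: P by apply: subsetUr.
have /andP[r0 r1] := r01 a.
pose g1 A := g (a |: A).
have V1 : Var P r g1 <= #|P|%:R * c ^+ 2.
  apply: IH => b A bP sAP; rewrite /g1 setUCA; apply: gc.
    exact: (subsetP sP).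
  by rewrite setUS.
have V0 : Var P r g <= #|P|%:R * c ^+ 2.
  apply: IH => b A bP sAP; apply: gc; first exact: (subsetP sP).
  exact: subset_trans sAP sP.
have E1 : `|Ex P r g1 - Ex P r g| <= c.
  have bnd A : A \subset P -> - c <= g1 A - g A <= c.
    move=> sAP; rewrite -ler_norml; apply: gc; rewrite ?setU11 //.
    exact: subset_trans sAP sP.
  have -> : Ex P r g1 - Ex P r g = Ex P r (fun A => g1 A - g A).
    rewrite ExD -[- Ex P r g]mulN1r -ExZ; congr (_ + _).
    by apply: eq_Ex => A _; rewrite mulN1r.
  rewrite ler_norml; apply/andP; split.
    by rewrite -(Ex_cst P r (- c)) ler_Ex // => A /bnd/andP[].
  by rewrite -[leRHS](Ex_cst P r c) ler_Ex // => A /bnd/andP[].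
have E2 : (Ex P r g1 - Ex P r g) ^+ 2 <= c ^+ 2.
  by rewrite -real_normK ?num_real // lerXn2r // nnegrE ?normr_ge0 // (le_trans _ E1).
rewrite cardsU1 aP natrD mulrDl mul1r.
have -> : Var (a |: P) r g = r a * Var P r g1 + (1 - r a) * Var P r g
    + r a * (1 - r a) * (Ex P r g1 - Ex P r g) ^+ 2.
  by rewrite !VarE !ExU1 // -/g1; ring.
have H1 := ler_wpM2l r0 V1.
have r1' : 0 <= 1 - r a by rewrite subr_ge0.
have H0 := ler_wpM2l r1' V0.
have H2 : r a * (1 - r a) * (Ex P r g1 - Ex P r g) ^+ 2 <= 1 * c ^+ 2.
  by apply: ler_pM; rewrite ?sqr_ge0 ?mulr_ge0 //; nra.
by lra.
Qed.

Lemma chebyshev P r g (t : R) : (forall e, 0 <= r e <= 1) -> 0 < t ->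
  Ex P r (fun A => (t <= `|g A - Ex P r g|)%R%:R) <= Var P r g / t ^+ 2.
Proof.
move=> r01 t0; rewrite ler_pdivlMr ?exprn_gt0 // mulrC -ExZ.
apply: ler_Ex => // A _; case: (leP t) => [tg|_]; last by rewrite mulr0 sqr_ge0.
by rewrite mulr1 -[leRHS]real_normK ?num_real // lerXn2r // nnegrE ?normr_ge0 // ltW.
Qed.

End RandomSubset.

(** * Comparing a product law with a mixture of product laws *)

Section Likelihood.
Variables (R : realFieldType) (T : finType) (P : {set T}) (q : R).
Hypotheses (q0 : 0 < q) (q1 : q < 1).
Implicit Types (r s : T -> R) (A : {set T}) (g : {set T} -> R).

Let p01 (e : T) : 0 <= q <= 1. Proof. by rewrite !ltW. Qed.

(** Density of the product law with rates r with respect to the one with the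
    constant rate q. *)
Definition likelihood r A : R :=
  \prod_(e in P) (if e \in A then r e / q else (1 - r e) / (1 - q)).

Lemma Ex_likelihood r g :
  Ex P r g = Ex P (fun=> q) (fun A => likelihood r A * g A).
Proof.
apply: eq_bigr => A _; rewrite mulrA; congr (_ * _).
rewrite /bern /likelihood -big_split; apply: eq_bigr => e _ /=.
have q1' : 1 - q != 0 by rewrite subr_eq0 gt_eqF.
by case: ifP => _; rewrite mulrC divfK // gt_eqF.
Qed.

(** The mean, at a single element e, of the product of the two densities; it is
    1 when one of the two rates equals q. *)
Definition chi_factor r s (e : T) : R :=
  1 + (r e - q) * (s e - q) / (q * (1 - q)).

Lemma Ex_likelihoodM r s :
  Ex P (fun=> q) (fun A => likelihood r A * likelihood s A) =
  \prod_(e in P) chi_factor r s e.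
Proof.
pose a e := r e / q * (s e / q).
pose b e := (1 - r e) / (1 - q) * ((1 - s e) / (1 - q)).
rewrite (@eq_Ex _ _ _ _ _
  (fun A => \prod_(e in P) (if e \in A then a e else b e))); last first.
  move=> A _; rewrite /likelihood -big_split; apply: eq_bigr => e _ /=.
  by case: ifP.
rewrite Ex_prod; apply: eq_bigr => e _; rewrite /a /b /chi_factor.
have q1' : 1 - q != 0 by rewrite subr_eq0 gt_eqF.
by field; rewrite q1' gt_eqF.
Qed.

(** With Lb the density of the mixture with respect to the rate-q law, the
    difference of the two expectations of g is the covariance of Lb and g.
    Bounding it by the weighted arithmetic-geometric inequality
    d h <= (V d^2 + h^2 / V) / 2 instead of Cauchy-Schwarz avoids a square
    root. *)
Lemma Ex_mixture_ge (I : finType) (J : {set I}) (r : I -> T -> R) g (V X : R) :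
  (0 < #|J|)%N -> 0 < V -> Var P (fun=> q) g <= V ->
  (\sum_(i in J) \sum_(j in J) \prod_(e in P) chi_factor (r i) (r j) e)
    / #|J|%:R ^+ 2 <= 1 + X ->
  Ex P (fun=> q) g <=
    (\sum_(i in J) Ex P (r i) g) / #|J|%:R + (V * X + 1) / 2.
Proof.
move=> J0 V0 gV HX; set m : R := #|J|%:R.
have m0 : m != 0 by rewrite pnatr_eq0 -lt0n.
pose E := Ex P (fun=> q); rewrite -/E.
pose Lb A := (\sum_(i in J) likelihood (r i) A) / m.
have ELb f : E (fun A => Lb A * f A) = (\sum_(i in J) Ex P (r i) f) / m.
  rewrite /E (@eq_Ex _ _ _ _ _
    (fun A => m^-1 * \sum_(i in J) likelihood (r i) A * f A)).
    rewrite ExZ Ex_sum mulrC; congr (_ / _).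
    by apply: eq_bigr => i _; rewrite -Ex_likelihood.
  by move=> A _; rewrite -mulr_suml /Lb mulrA [m^-1 * _]mulrC.
have ELb1 : E Lb = 1.
  rewrite /E (@eq_Ex _ _ _ _ _ (fun A => Lb A * 1)); last first.
    by move=> A _; rewrite mulr1.
  rewrite -/E ELb (eq_bigr (fun=> 1)) => [|i _]; last by rewrite Ex_cst.
  by rewrite sumr_const divff.
have ELb2 : E (fun A => Lb A ^+ 2) <= 1 + X.
  apply: le_trans HX; rewrite -/m.
  rewrite /E (@eq_Ex _ _ _ _ _ (fun A => m^-2 *
     \sum_(i in J) \sum_(j in J) likelihood (r i) A * likelihood (r j) A)).
    rewrite ExZ Ex_sum mulrC ler_wpM2r ?invr_ge0 ?sqr_ge0 //.
    rewrite le_eqVlt; apply/orP; left; apply/eqP; apply: eq_bigr => i _.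
    rewrite Ex_sum; apply: eq_bigr => j _; exact: Ex_likelihoodM.
  move=> A _; rewrite /Lb exprMn exprVn mulrC; congr (_ * _).
  rewrite expr2 mulr_suml; apply: eq_bigr => i _.
  by rewrite mulr_sumr.
rewrite -ELb; set mu := E g.
have key : mu - E (fun A => Lb A * g A) =
   - E (fun A => (Lb A - 1) * (g A - mu)).
  rewrite /E (@eq_Ex _ _ _ _ (fun A => (Lb A - 1) * (g A - mu))
    (fun A => Lb A * g A + (-1 * g A + (- mu * Lb A + mu)))); last first.
    by move=> A _; ring.
  by rewrite !ExD !ExZ Ex_cst -/E ELb1 -/mu; ring.
have amgm : - E (fun A => (Lb A - 1) * (g A - mu)) <=
   E (fun A => V / 2 * (Lb A - 1) ^+ 2 + (2 * V)^-1 * (g A - mu) ^+ 2).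
  rewrite /E -[leLHS]mulN1r -ExZ; apply: ler_Ex => // A _.
  set d := Lb A - 1; set h := g A - mu.
  have -> : V / 2 * d ^+ 2 + (2 * V)^-1 * h ^+ 2 =
            -1 * (d * h) + (2 * V)^-1 * (V * d + h) ^+ 2.
    by field; rewrite gt_eqF.
  by rewrite lerDl mulr_ge0 ?sqr_ge0 // invr_ge0 mulr_ge0 // ltW.
have ED : E (fun A => (Lb A - 1) ^+ 2) <= X.
  rewrite /E (@eq_Ex _ _ _ _ _ (fun A => Lb A ^+ 2 + (- 2 * Lb A + 1))).
    by rewrite !ExD ExZ Ex_cst -/E ELb1; lra.
  by move=> A _; ring.
rewrite -lerBlDl key (le_trans amgm) // /E ExD !ExZ -/E.
have -> : (V * X + 1) / 2 = V / 2 * X + (2 * V)^-1 * V.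
  by field; rewrite gt_eqF.
apply: lerD; first by apply: ler_wpM2l; rewrite // divr_ge0 // ltW.
by apply: ler_wpM2l gV; rewrite invr_ge0 mulr_ge0 // ltW.
Qed.

End Likelihood.

(** * Overlaps of vertex sets of a fixed size *)

Section KSets.
Variable V : finType.
Implicit Types (S J K L : {set V}) (e : {set V}).

Definition ksets k : {set {set V}} := [set K : {set V} | #|K| == k].

Definition pairs S : {set {set V}} := [set e : {set V} | e \subset S & #|e| == 2%N].

Lemma card_pairs S : #|pairs S| = 'C(#|S|, 2).
Proof. exact: cards_draws. Qed.

Lemma pairs_subset S : pairs S \subset vpairs V.
Proof. by apply/subsetP => e; rewrite !inE => /andP[]. Qed.

Lemma card_pairs_le S l : (#|S| <= l)%N -> (#|pairs S| <= l ^ 2)%N.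
Proof.
by move=> Sl; rewrite card_pairs (leq_trans (bin2_le (leqnn _))) // mulnn leq_sqr.
Qed.

Lemma pairsI S1 S2 : pairs (S1 :&: S2) = pairs S1 :&: pairs S2.
Proof.
apply/setP => e; rewrite !inE subsetI.
by case: (#|e| == 2%N); rewrite ?andbT ?andbF.
Qed.

Lemma card_ksets k : #|ksets k| = 'C(#|V|, k).
Proof. exact: card_draws. Qed.

(** The k-sets containing J are J together with the (k - |J|)-subsets of its
    complement. *)
Lemma card_ksets_sup J k : (#|J| <= k)%N ->
  #|[set K in ksets k | J \subset K]| = 'C(#|V| - #|J|, k - #|J|).
Proof.
move=> Jk; pose D := [set L : {set V} | L \subset ~: J & #|L| == (k - #|J|)%N].
have -> : [set K in ksets k | J \subset K] = [set J :|: L | L in D].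
  apply/setP => K; rewrite !inE; apply/andP/imsetP => [[/eqP cK sJK]|[L]].
    exists (K :\: J); last by rewrite setDE setUIr setUCr setIT (setUidPr sJK).
    by rewrite inE subDset setUCr subsetT cardsD (setIidPr sJK) cK eqxx.
  rewrite inE => /andP[sLJ /eqP cL] ->; split; last exact: subsetUl.
  rewrite cardsU cL (_ : J :&: L = set0) ?cards0 ?subn0 ?subnKC //.
  by apply/eqP; rewrite setI_eq0 disjoint_sym disjoints_subset.
rewrite card_in_imset; first by rewrite /D cards_draws cardsCs setCK.
move=> L1 L2; rewrite !inE => /andP[s1 _] /andP[s2 _] E12.
have H L : L \subset ~: J -> (J :|: L) :&: ~: J = L.
  by move=> sL; rewrite setIUl setICr set0U (setIidPl sL).
by rewrite -(H L1 s1) E12 H.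
Qed.

Variable R : realFieldType.

Lemma card_ksets_sup_le J k : (k <= #|V|)%N ->
  #|[set K in ksets k | J \subset K]|%:R <=
  #|ksets k|%:R * (k%:R / #|V|%:R) ^+ #|J| :> R.
Proof.
move=> kn; have [Jk|Jk] := leqP #|J| k; last first.
  rewrite (_ : [set K in ksets k | J \subset K] = set0).
    by rewrite cards0 mulr_ge0 // exprn_ge0 // divr_ge0.
  apply/setP => K; rewrite !inE; apply/andP => -[/eqP cK /subset_leq_card].
  by rewrite cK leqNgt Jk.
rewrite card_ksets_sup // card_ksets.
have [n0|n0] := posnP #|V|.
  have k0 : k = 0%N by lia.
  have j0 : #|J| = 0%N by lia.
  by rewrite n0 k0 j0 expr0 mulr1.
rewrite expr_div_n mulrA ler_pdivlMr ?exprn_gt0 ?ltr0n //.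
by rewrite -!natrX -!natrM ler_nat bin_sub_le // Jk kn.
Qed.

Lemma card_ksets_sup2 e k : (2 <= k <= #|V|)%N -> #|e| = 2%N ->
  #|[set K in ksets k | e \subset K]|%:R =
  #|ksets k|%:R * ('C(k, 2)%:R / 'C(#|V|, 2)%:R) :> R.
Proof.
move=> kn e2; have /andP[k2 kV] := kn; rewrite card_ksets_sup e2 // card_ksets.
rewrite mulrA; apply/(canRL (mulfK _)).
  by rewrite pnatr_eq0 -lt0n bin_gt0 (leq_trans k2).
by rewrite -!natrM bin_sub2.
Qed.

(** Double counting of the pairs (e, L) with e a pair contained in both K and
    L. *)
Lemma sum_overlap K k : (2 <= k <= #|V|)%N -> #|K| = k ->
  \sum_(L in ksets k) 'C(#|K :&: L|, 2)%:R =
  #|ksets k|%:R * ('C(k, 2)%:R * ('C(k, 2)%:R / 'C(#|V|, 2)%:R)) :> R.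
Proof.
move=> kn cK.
transitivity (\sum_(e in pairs K) #|[set L in ksets k | e \subset L]|%:R : R).
  transitivity (\sum_(L in ksets k) \sum_(e in pairs K | e \subset L) 1 : R).
    apply: eq_bigr => L _; rewrite sumr_const -card_pairs pairsI.
    congr _%:R; apply: eq_card => e; rewrite [RHS]unfold_in !inE.
    by case: (#|e| == 2%N); rewrite ?andbT ?andbF.
  rewrite (exchange_big_dep (mem (pairs K))) /=; last by move=> L e _ /andP[].
  apply: eq_bigr => e eK; rewrite sumr_const; congr _%:R; apply: eq_card => L.
  by rewrite [LHS]unfold_in eK !inE.
rewrite (eq_bigr (fun=> #|ksets k|%:R * ('C(k, 2)%:R / 'C(#|V|, 2)%:R))).
  by rewrite sumr_const card_pairs cK; ring.
by move=> e; rewrite inE => /andP[_ /eqP e2]; rewrite card_ksets_sup2.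
Qed.

(** The linear term is exact, and it is what the choice of the densities in a
    planting step cancels.  Only overlaps in at least 3 vertices go into the
    error term: they are summed over all possible intersections J by a union
    bound, where w ^+ 'C(|J|, 2) <= x ^+ |J| absorbs the weight, so each vertex
    of J costs a factor k x / n. *)
Lemma sum_overlap_exp K k (w x : R) : (2 <= k)%N -> #|K| = k ->
  1 <= w -> w ^+ k <= x -> 2 ^+ k <= x -> k%:R * x <= #|V|%:R ->
  \sum_(L in ksets k) w ^+ 'C(#|K :&: L|, 2) <=
  #|ksets k|%:R * (1 + (w - 1) * ('C(k, 2)%:R * ('C(k, 2)%:R / 'C(#|V|, 2)%:R))
                   + x * (k%:R * x / #|V|%:R) ^+ 3).
Proof.
move=> k2 cK w1 wx x2 kx.
have x1 : 1 <= x by apply: le_trans wx; rewrite exprn_ege1.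
have kV : (k <= #|V|)%N.
  rewrite -(ler_nat R) (le_trans _ kx) // ler_peMr //.
have n0 : 0 < #|V|%:R :> R by rewrite ltr0n; lia.
set y := k%:R * x / #|V|%:R.
have y0 : 0 <= y by rewrite divr_ge0 // mulr_ge0 // (le_trans _ x1).
have y1 : y <= 1 by rewrite ler_pdivrMr // mul1r.
pose F L J : R := if J \subset L then x ^+ #|J| else 0.
have F0 L J : 0 <= F L J.
  by rewrite /F; case: ifP => // _; rewrite exprn_ge0 // (le_trans _ x1).
have pw L : w ^+ 'C(#|K :&: L|, 2) <= 1 + (w - 1) * 'C(#|K :&: L|, 2)%:R
     + \sum_(J : {set V} | (J \subset K) && (3 <= #|J|)%N) F L J.
  have [j3|j3] := leqP 3 #|K :&: L|.
    (* The term J = K :&: L of the sum already dominates. *)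
    rewrite (bigD1 (K :&: L)) /= ?subsetIl //.
    have -> : F L (K :&: L) = x ^+ #|K :&: L| by rewrite /F subsetIr.
    have H : w ^+ 'C(#|K :&: L|, 2) <= x ^+ #|K :&: L|.
      apply: le_trans (_ : (w ^+ k) ^+ #|K :&: L| <= _); last first.
        by rewrite lerXn2r // nnegrE ?exprn_ge0 // (le_trans _ w1, le_trans _ x1).
      rewrite -exprM; apply: ler_weXn2l => //; rewrite mulnC bin2_le // -cK.
      by rewrite subset_leq_card // subsetIl.
    apply: (le_trans H); rewrite addrCA lerDl addr_ge0 ?sumr_ge0 //.
    by rewrite addr_ge0 // mulr_ge0 ?subr_ge0.
  rewrite -[leLHS]addr0 lerD ?sumr_ge0 //.
  case: #|K :&: L| j3 => [|[|[|]]] // _;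
    by rewrite ?bin0n /= ?expr0 ?expr1 ?mulr0 ?mulr1 ?addr0 // addrC subrK.
apply: le_trans (ler_sum _ (fun L _ => pw L)) _.
rewrite 2!big_split /= sumr_const -mulr_sumr sum_overlap ?k2 //.
set m : R := #|ksets k|%:R; set c := 'C(k, 2)%:R * _.
suff H : \sum_(L in ksets k)
    \sum_(J : {set V} | (J \subset K) && (3 <= #|J|)%N) F L J <= m * (x * y ^+ 3).
  by rewrite !mulrDr mulr1 lerD // lerD // mulrCA.
rewrite exchange_big /=.
apply: le_trans (_ : \sum_(J in powerset K) m * y ^+ 3 <= _).
  rewrite [leRHS](bigID (fun J : {set V} => (3 <= #|J|)%N)) /=.
  rewrite -[leLHS]addr0 lerD ?sumr_ge0 //; last first.
    by move=> J _; rewrite mulr_ge0 ?exprn_ge0.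
  under [leRHS]eq_bigl do rewrite powersetE.
  apply: ler_sum => J /andP[_ J3].
  have -> : \sum_(L in ksets k) F L J =
            #|[set L in ksets k | J \subset L]|%:R * x ^+ #|J|.
    rewrite /F -big_mkcondr /= sumr_const -[LHS]mulr_natl; congr (_%:R * _).
    by apply: eq_card => L; rewrite unfold_in !inE.
  apply: le_trans (ler_wpM2r _ (card_ksets_sup_le J kV)) _.
    by rewrite exprn_ge0 // (le_trans _ x1).
  rewrite -mulrA ler_wpM2l // -exprMn mulrAC -/y.
  by rewrite ler_wiXn2l.
rewrite sumr_const card_powerset cK -mulr_natl natrX.
by rewrite mulrCA ler_wpM2l // ler_wpM2r ?exprn_ge0.
Qed.
End KSets.

(** * Covers by cliques of bounded size and multiplicity *)

Section CappedCover.
Variables (V : finType) (l D : nat).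
Implicit Types (K e : {set V}) (A S F : {set {set V}}).

Definition mult F e : nat := #|[set K in F | e \subset K]|.

(** The bounds on the sizes and multiplicities limit the damage of deleting an
    edge to D * l ^ 2 newly uncovered edges. *)
Definition capped A F : bool :=
  [forall K in F, (#|K| <= l)%N && (pairs K \subset A)] &&
  [forall e in vpairs V, (mult F e <= D)%N].

Definition uncovered A F : {set {set V}} := A :\: \bigcup_(K in F) pairs K.

Definition cost A F : nat := (#|F| + #|uncovered A F|)%N.

Definition capped_cover A : nat :=
  cost A [arg min_(F < set0 | capped A F) cost A F].

Lemma cappedP A F : reflect
  [/\ forall K, K \in F -> (#|K| <= l)%N, forall K, K \in F -> pairs K \subset A
    & forall e, e \in vpairs V -> (mult F e <= D)%N] (capped A F).
Proof.
apply: (iffP andP) => [[/forall_inP HK /forall_inP He]|[Hl HK He]].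
  by split=> // K /HK/andP[].
by split; apply/forall_inP => // K KF; rewrite Hl ?HK.
Qed.

Lemma capped0 A : capped A set0.
Proof.
apply/cappedP; split=> [K|K|e _]; rewrite ?inE // /mult.
by rewrite (_ : [set _ in _ | _] = set0) ?cards0 //; apply/setP => K; rewrite !inE.
Qed.

Lemma capped_coverP A :
  (exists2 F, capped A F & cost A F = capped_cover A) /\
  (forall F, capped A F -> (capped_cover A <= cost A F)%N).
Proof.
rewrite /capped_cover; case: arg_minnP; first exact: capped0.
by move=> F AF Fmin; split => //; exists F.
Qed.

Lemma capped_cover_le A : (capped_cover A <= #|A|)%N.
Proof.
apply: leq_trans ((capped_coverP A).2 _ (capped0 A)) _.
by rewrite /cost cards0 subset_leq_card // subsetDl.
Qed.

Lemma capped_coverU A S : (capped_cover (A :|: S) <= capped_cover A + #|S|)%N.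
Proof.
have [[F /cappedP[Fl FK Fe] <-] _] := capped_coverP A.
have AF : capped (A :|: S) F.
  apply/cappedP; split=> // K KF; exact: subset_trans (FK K KF) (subsetUl _ _).
apply: leq_trans ((capped_coverP _).2 _ AF) _; rewrite /cost -addnA leq_add2l.
apply: leq_trans (leq_card_setU (uncovered A F) S).
by rewrite subset_leq_card // /uncovered setDUl setUS // subsetDl.
Qed.

(** Drop the members of an optimal family that contain e, and pay for the edges
    which they covered. *)
Lemma capped_cover_del A e : e \in vpairs V ->
  (capped_cover A <= capped_cover (e |: A) + D * l ^ 2)%N.
Proof.
move=> eV; have [[F /cappedP[Fl FK Fe] <-] _] := capped_coverP (e |: A).
pose F' := F :\: [set K in F | e \subset K].
have sF : F' \subset F by apply: subsetDl.
have AF : capped A F'.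
  apply/cappedP; split=> [K KF|K KF|e' /Fe]; first exact: Fl (subsetP sF _ KF).
    have := FK K (subsetP sF _ KF); move=> /subsetP sK; apply/subsetP => f fK.
    have := sK f fK; rewrite !inE => /orP[/eqP fe|//].
    by move: KF fK; rewrite !inE fe => /andP[/nandP[/negbTE->//|/negbTE->]].
  apply: leq_trans; rewrite /mult subset_leq_card //; apply/subsetP => K.
  by rewrite !inE => /andP[/andP[_ ->] ->].
apply: leq_trans ((capped_coverP _).2 _ AF) _; rewrite /cost -addnA.
apply: leq_add; first exact: subset_leq_card.
have sU : uncovered A F' \subset
    uncovered (e |: A) F :|: \bigcup_(K in [set K in F | e \subset K]) pairs K.
  apply/subsetP => f; rewrite !inE => /andP[fF' fA]; rewrite fA orbT andbT.
  apply/orP; have [|] := boolP (f \in \bigcup_(K in F) pairs K); last by left.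
  case/bigcupP => K KF fK; right; apply/bigcupP; exists K => //.
  apply: contraR fF' => KF'; apply/bigcupP; exists K => //.
  by rewrite !inE KF andbT -[X in X && _]KF; rewrite !inE in KF'.
apply: leq_trans (subset_leq_card sU) _.
apply: leq_trans (leq_card_setU _ _) _; rewrite leq_add2l.
apply: leq_trans (card_bigcup_le _ _) _.
apply: leq_trans (_ : \sum_(K in [set K in F | e \subset K]) l ^ 2 <= _)%N.
  by apply: leq_sum => K; rewrite inE => /andP[KF _]; rewrite card_pairs_le ?Fl.
by rewrite sum_nat_const leq_mul2r Fe ?orbT.
Qed.

Definition saturated F : {set {set V}} := [set e in vpairs V | mult F e == D].

(** Each saturated pair is covered D times, while a family of cliques of size at
    most l covers at most |F| * l ^ 2 pairs with multiplicity. *)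
Lemma saturated_le A F : capped A F -> (D * #|saturated F| <= #|F| * l ^ 2)%N.
Proof.
case/cappedP => Fl _ _; rewrite mulnC -sum_nat_const.
apply: leq_trans (_ : \sum_(e in vpairs V) mult F e <= _)%N.
  rewrite [leqRHS](bigID (mem (saturated F))) /=.
  rewrite (eq_bigl (fun e => (e \in vpairs V) && (e \in saturated F))); last first.
    by move=> e; rewrite !inE; case: (#|e| == 2%N).
  apply: leq_trans (leq_addr _ _); apply: leq_sum => e /andP[_].
  by rewrite !inE => /andP[_ /eqP->].
rewrite -sum_nat_const.
under eq_bigr do rewrite /mult -sum1_card.
rewrite (exchange_big_dep (mem F)) /=; last by move=> e K _; rewrite inE => /andP[].
apply: leq_sum => K KF; rewrite sum1_card.
apply: leq_trans (card_pairs_le (Fl K KF)).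
rewrite subset_leq_card //; apply/subsetP => e.
by rewrite unfold_in !inE => /and3P[-> _ ->].
Qed.

(** The new clique can join an optimal family unless it contains a saturated
    pair; in that case its edges are paid for one by one. *)
Lemma capped_cover_plant A F K : capped A F -> cost A F = capped_cover A ->
  (#|K| <= l)%N ->
  (capped_cover (A :|: pairs K) <=
   capped_cover A + 1 + #|pairs K| * #|pairs K :&: saturated F|)%N.
Proof.
move=> AF cF Kl; have [E|] := eqVneq (pairs K :&: saturated F) set0; last first.
  rewrite -card_gt0 => H; apply: leq_trans (capped_coverU _ _) _.
  by rewrite -addnA leq_add2l (leq_trans (leq_pmulr _ H)) // leq_addl.
apply: leq_trans (leq_addr _ _); have /cappedP[Fl FK Fe] := AF.
have UF : capped (A :|: pairs K) (K |: F).
  apply/cappedP; split=> [L|L|e eV].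
  - by rewrite !inE => /orP[/eqP->//|/Fl].
  - rewrite !inE => /orP[/eqP->|/FK sL]; first exact: subsetUr.
    exact: subset_trans sL (subsetUl _ _).
  have [eK|eK] := boolP (e \subset K); last first.
    apply: leq_trans (Fe e eV); rewrite /mult subset_leq_card //.
    apply/subsetP => L; rewrite !inE => /andP[/orP[/eqP LK|-> //] eL].
    by rewrite -LK eL in eK.
  apply: leq_trans (_ : (mult F e).+1 <= _)%N.
    rewrite -add1n -(cards1 K); apply: leq_trans (leq_card_setU _ _).
    rewrite subset_leq_card //; apply/subsetP => L; rewrite !inE.
    by case/andP => /orP[->//|-> ->]; rewrite orbT.
  rewrite ltn_neqAle Fe // andbT; apply/negP => me.
  have : e \in pairs K :&: saturated F.
    by rewrite !inE eK me; rewrite inE in eV; rewrite eV.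
  by rewrite E inE.
apply: leq_trans ((capped_coverP _).2 _ UF) _; rewrite -cF /cost addnAC.
apply: leq_add.
  by rewrite addnC -(cards1 K) leq_card_setU.
rewrite subset_leq_card // /uncovered; apply/subsetP => e; rewrite !inE.
case/andP => eN /orP[->|eK].
  rewrite andbT; apply: contra eN => /bigcupP[L LF eL].
  by apply/bigcupP; exists L; rewrite // inE LF orbT.
by case/negP: eN; apply/bigcupP; exists K; rewrite !inE ?eqxx.
Qed.

Lemma theta1_le_capped (G : sgraph V) : (theta1 G <= capped_cover (edges G))%N.
Proof.
have [[F /cappedP[_ FK _] <-] _] := capped_coverP (edges G).
apply: leq_trans (leq_card_setU F (uncovered (edges G) F)).
apply: (theta1P G).2; apply/andP; split.
  apply/forall_inP => K; rewrite inE => /orP[/FK sK|].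
    apply/forall_inP => u uK; apply/forall_inP => v vK; apply/implyP => uv.
    by apply: (subsetP sK); rewrite inE cards2 uv andbT subUset !sub1set uK.
  rewrite inE => /andP[_ KG]; have /andP[/forall_inP + _] := edges_clique_cover G.
  exact.
apply/forall_inP => e eG; apply/exists_inP.
have [/bigcupP[K KF]|eN] := boolP (e \in \bigcup_(K in F) pairs K).
  by rewrite inE => /andP[eK _]; exists K; rewrite // inE KF.
by exists e; rewrite // in_setU in_setD eN eG orbT.
Qed.

Variable R : realFieldType.

Lemma capped_cover_lipschitz A e : e \in vpairs V -> (0 < D * l ^ 2)%N ->
  `|(capped_cover (e |: A))%:R - (capped_cover A)%:R : R| <= (D * l ^ 2)%N%:R.
Proof.
move=> eV D0; rewrite ler_distl lerBlDr -!natrD !ler_nat capped_cover_del //=.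
rewrite setUC (leq_trans (capped_coverU _ _)) // cards1 leq_add2l.
exact: D0.
Qed.

(** With D = l ^ 6 saturated pairs are so rare that a random k-set contains, on
    average, at most 1 / 'C(k, 2) of them. *)
Lemma capped_cover_plant_avg A k : (2 <= k <= #|V|)%N -> (k <= l)%N ->
  A \subset vpairs V -> D = (l ^ 6)%N ->
  \sum_(K in ksets V k) (capped_cover (A :|: pairs K))%:R <=
  #|ksets V k|%:R * ((capped_cover A)%:R + 2) :> R.
Proof.
move=> kn kl AV DE; have [[F AF cF] _] := capped_coverP A.
have /andP[k2 kV] := kn.
have l0 : (0 < l)%N by lia.
set m : R := #|ksets V k|%:R.
apply: le_trans (_ : \sum_(K in ksets V k) ((capped_cover A)%:R + 1 +
   'C(k, 2)%:R * #|pairs K :&: saturated F|%:R) <= _).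
  apply: ler_sum => K; rewrite inE => /eqP cK.
  have := capped_cover_plant AF cF; move=> /(_ K); rewrite cK => /(_ kl).
  by rewrite card_pairs cK -(ler_nat R) !natrD natrM.
rewrite big_split /= sumr_const -[X in X + _ <= _]mulr_natl -/m -mulr_sumr.
have -> : (capped_cover A)%:R + 2 = (capped_cover A)%:R + 1 + 1 :> R by ring.
rewrite [leRHS]mulrDr lerD2l mulr1.
have -> : \sum_(K in ksets V k) #|pairs K :&: saturated F|%:R =
   #|saturated F|%:R * (m * ('C(k, 2)%:R / 'C(#|V|, 2)%:R)) :> R.
  transitivity (\sum_(e in saturated F) #|[set K in ksets V k | e \subset K]|%:R : R).
    transitivity (\sum_(K in ksets V k) \sum_(e in saturated F | e \subset K) 1 : R).
      apply: eq_bigr => K _; rewrite sumr_const; congr _%:R; apply: eq_card => e.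
      by rewrite [RHS]unfold_in !inE; case: (#|e| == _); rewrite ?andbF ?andbT // andbC.
    rewrite (exchange_big_dep (mem (saturated F))) /=; last by move=> K e _ /andP[].
    apply: eq_bigr => e eS; rewrite sumr_const; congr _%:R; apply: eq_card => K.
    by rewrite [LHS]unfold_in eS !inE.
  rewrite (eq_bigr (fun=> m * ('C(k, 2)%:R / 'C(#|V|, 2)%:R))).
    by rewrite sumr_const [RHS]mulr_natl.
  by move=> e; rewrite !inE => /andP[/eqP e2 _]; rewrite card_ksets_sup2.
have m0 : 0 < m by rewrite ltr0n card_ksets bin_gt0.
rewrite [X in _ * X]mulrCA [leLHS]mulrCA (ger_pMr _ m0).
set N := 'C(#|V|, 2).
have N0 : 0 < N%:R :> R by rewrite ltr0n bin_gt0 (leq_trans k2).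
have HF : (#|F| <= N)%N.
  apply: leq_trans (leq_addr #|uncovered A F| _) _; rewrite -/(cost A F) cF.
  apply: leq_trans (capped_cover_le _) _.
  have -> : N = #|vpairs V| by rewrite /N -card_draws.
  exact: subset_leq_card.
have HS := saturated_le AF.
rewrite mulrA mulrA ler_pdivrMr // mul1r -!natrM ler_nat.
have Ck : ('C(k, 2) <= l ^ 2)%N.
  by rewrite (leq_trans (bin2_le kl)) // -mulnn leq_mul2r kl orbT.
rewrite -(@leq_pmul2l (l ^ 6)) ?expn_gt0 ?l0 // -{1}DE.
apply: leq_trans (_ : (D * #|saturated F|) * (l ^ 2 * l ^ 2) <= _)%N.
  have -> (d c s : nat) : (d * (c * s * c) = (d * s) * (c * c))%N by ring.
  by rewrite leq_mul2l leq_mul ?orbT.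
apply: leq_trans (leq_mul HS (leqnn _)) _.
by rewrite -mulnA -!expnD /= mulnC leq_mul2l HF orbT.
Qed.

End CappedCover.

(** * The law of a random graph with one planted clique *)

Section Planting.
Variable R : realType.

Variables (V : finType) (k : nat) (q : R).
Hypotheses (q0 : 0 < q) (q1 : q < 1).

Let n := #|V|.
Let N : R := 'C(n, 2)%:R.
Let B : R := 'C(k, 2)%:R.

(** The probability that a given pair lies in a uniformly random k-set. *)
Definition edge_prob : R := B / N.
(** The density q' with 1 - q = (1 - q') (1 - edge_prob): planting a random
    k-clique in G(n, q') gives every pair the marginal probability q. *)
Definition planted_rate : R :=
  q - (1 - q) * (edge_prob / (1 - edge_prob)).
Definition planted_law (K : {set V}) (e : {set V}) : R :=
  if e \in pairs K then 1 else planted_rate.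

Let d := q - planted_rate.
Let w := expR (2 * d / q) / q.
Let beta := d ^+ 2 / (q * (1 - q)).

Hypotheses (d0 : 0 <= d) (dq : d <= q).

(** The three kinds of pairs contribute 1/q (in both sets), 1 - d/q (in exactly
    one) and 1 + beta (in none).  Bounding the last two by exponentials turns
    the product into a constant times w ^+ (number of common pairs), the factor
    e^(2d/q) in w compensating for common pairs being counted twice in the
    second kind. *)
Lemma chi_planted_le (K L : {set V}) : #|K| = k -> #|L| = k ->
  \prod_(e in vpairs V) chi_factor q (planted_law K) (planted_law L) e <=
  w ^+ 'C(#|K :&: L|, 2) * expR (- (2 * B * d / q) + N * beta).
Proof.
move=> cK cL.
have qn : q != 0 by rewrite gt_eqF.
have q1n : 1 - q != 0 by rewrite subr_eq0 gt_eqF.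
have q1p : 0 < 1 - q by rewrite subr_gt0.
have b0 : 0 <= beta by rewrite divr_ge0 ?sqr_ge0 // mulr_ge0 // ltW.
pose c := expR (- (d / q)).
apply: le_trans (_ : \prod_(e in vpairs V)
   ((if e \in pairs (K :&: L) then w else 1) *
    ((if e \in pairs K then c else 1) * (if e \in pairs L then c else 1)) *
    expR beta) <= _); last first.
  rewrite !big_split /= !prod_if_in ?pairs_subset // prodr_const !card_pairs cK cL.
  rewrite -mulrA ler_wpM2l ?exprn_ge0 ?divr_ge0 ?expR_ge0 ?(ltW q0) //.
  rewrite -exprD /c -!expRM_natl -expRD ler_expR.
  have -> : #|vpairs V| = 'C(n, 2) by rewrite /n -card_draws.
  by rewrite natrD -/B -/N le_eqVlt; apply/orP; left; apply/eqP; field.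
apply: ler_prod => e _; rewrite pairsI in_setI /chi_factor /planted_law.
have -> : planted_rate = q - d by rewrite /d; ring.
have eb : 1 <= expR beta by rewrite -expR0 ler_expR.
have c0 : 0 <= c by apply: expR_ge0.
have c1 : 1 - d / q <= c by apply: le_trans (expR_ge1Dx _).
have dq1 : d / q <= 1 by rewrite ler_pdivrMr // mul1r.
have cross : 1 + (1 - q) * (q - d - q) / (q * (1 - q)) = 1 - d / q.
  by field; rewrite q1n qn.
case: (e \in pairs K); case: (e \in pairs L) => /=.
- have -> : 1 + (1 - q) * (1 - q) / (q * (1 - q)) = q^-1 by field; rewrite q1n qn.
  have -> : w * (c * c) = q^-1.
    rewrite /w /c -expRD mulrAC -expRD (_ : _ + _ = 0) ?expR0 ?mul1r //.
    by field.
  by rewrite invr_ge0 ltW //= ler_peMr // invr_ge0 ltW.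
- rewrite cross subr_ge0 dq1 /= mulr1 mul1r (le_trans c1) //.
  by rewrite ler_peMr.
- rewrite [(q - d - q) * _]mulrC cross subr_ge0 dq1 /= !mul1r (le_trans c1) //.
  by rewrite ler_peMr.
rewrite !mul1r (_ : (q - d - q) * (q - d - q) / (q * (1 - q)) = beta).
  by rewrite addr_ge0 //= expR_ge1Dx.
by rewrite /beta; congr (_ / _); ring.
Qed.

(** The terms of first order in edge_prob cancel: with
    a = edge_prob / (1 - edge_prob) the exponent of the prefactor is
    (1 - q) / q * B * (a^2 - a), while the pairs shared by two random k-sets
    contribute (1 - q) / q * B * a up to higher order. *)
Lemma chi_planted_avg (x : R) : (2 <= k <= n)%N -> 0 < N -> edge_prob < 1 ->
  1 <= w -> w ^+ k <= x -> 2 ^+ k <= x -> k%:R * x <= n%:R -> 2 * d / q <= 2^-1 ->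
  (\sum_(K in ksets V k) \sum_(L in ksets V k)
     \prod_(e in vpairs V) chi_factor q (planted_law K) (planted_law L) e)
   / #|ksets V k|%:R ^+ 2 <=
  expR (5 * B * (edge_prob / (1 - edge_prob)) ^+ 2 / q ^+ 2 +
        x * (k%:R * x / n%:R) ^+ 3).
Proof.
move=> kn N0 ep1 w1 wx x2 kx dq4.
have /andP[k2 kV] := kn.
set m : R := #|ksets V k|%:R.
have m0 : 0 < m by rewrite ltr0n card_ksets bin_gt0.
set eta := x * _ ^+ 3.
set E := expR (- (2 * B * d / q) + N * beta).
apply: le_trans (_ : E * (1 + (w - 1) * (B * (B / N)) + eta) <= _).
  rewrite ler_pdivrMr ?exprn_gt0 //.
  apply: le_trans (_ : \sum_(K in ksets V k)
      (m * (E * (1 + (w - 1) * (B * (B / N)) + eta))) <= _).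
    apply: ler_sum => K; rewrite inE => /eqP cK.
    have H := sum_overlap_exp k2 cK w1 wx x2 kx.
    rewrite mulrCA; apply: le_trans (ler_wpM2l (expR_ge0 _) H).
    rewrite mulr_sumr; apply: ler_sum => L; rewrite inE => /eqP cL.
    by rewrite mulrC chi_planted_le.
  by rewrite sumr_const -[leLHS]mulr_natl -/m mulrA -expr2 mulrC.
apply: le_trans (_ : E * expR ((w - 1) * (B * (B / N)) + eta) <= _).
  by rewrite ler_wpM2l ?expR_ge0 // -addrA expR_ge1Dx.
rewrite -expRD ler_expR addrA lerD2r.
set a := edge_prob / (1 - edge_prob).
have ep0 : 0 <= edge_prob by rewrite divr_ge0 // ltW.
have a0 : 0 <= a by rewrite divr_ge0 // subr_ge0 ltW.
have B0 : 0 <= B by [].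
have qn : q != 0 by rewrite gt_eqF.
have q1n : 1 - q != 0 by rewrite subr_eq0 gt_eqF.
have dE : d = (1 - q) * a by rewrite /d /planted_rate -/a; ring.
have epa : edge_prob <= a.
  by rewrite ler_pdivlMr ?subr_gt0 // ler_piMr // lerBlDr lerDl.
have NB : N * a ^+ 2 = B * a * (1 + a).
  rewrite /a /edge_prob; field; rewrite (gt_eqF N0) /=.
  by move: ep1; rewrite /edge_prob ltr_pdivrMr // mul1r -subr_gt0 => /gt_eqF->.
have w1' : w - 1 <= (1 - q) / q + 4 * d / q ^+ 2.
  have H : expR (2 * d / q) <= 1 + 2 * (2 * d / q).
    by apply: expR_le1D2; rewrite dq4 divr_ge0 ?mulr_ge0 // ltW.
  have -> : (1 - q) / q + 4 * d / q ^+ 2 = (1 + 2 * (2 * d / q)) / q - 1 by field.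
  by rewrite lerD2r ler_wpM2r // invr_ge0 ltW.
have Hw : (w - 1) * (B * (B / N)) <= ((1 - q) / q + 4 * d / q ^+ 2) * (B * a).
  by apply: ler_pM => //; rewrite ?subr_ge0 ?mulr_ge0 ?ler_wpM2l ?invr_ge0 ?(ltW N0).
apply: le_trans (lerD (lexx _) Hw) _.
have -> : - (2 * B * d / q) + N * beta =
   ((1 - q) / q) * (- (2 * B * a) + N * a ^+ 2).
  by rewrite /beta dE; field; rewrite q1n qn.
rewrite NB dE.
have -> : (1 - q) / q * (- (2 * B * a) + B * a * (1 + a)) +
  ((1 - q) / q + 4 * ((1 - q) * a) / q ^+ 2) * (B * a) =
  B * a ^+ 2 * (((1 - q) * q + 4 * (1 - q)) / q ^+ 2) by field.
have -> : 5 * B * a ^+ 2 / q ^+ 2 = B * a ^+ 2 * (5 / q ^+ 2) by field.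
apply: ler_wpM2l; first by rewrite mulr_ge0 ?sqr_ge0.
rewrite ler_wpM2r ?invr_ge0 ?sqr_ge0 //.
have qq : 0 <= q * q by rewrite mulr_ge0 // ltW.
by have := q0; lra.
Qed.

End Planting.

Section Step.
Variables (R : realType) (V : finType) (k l : nat) (q x : R).
Let n : R := #|V|%:R.
Hypotheses (q0 : 0 < q) (q1 : q < 1) (k2 : (2 <= k)%N) (kl : (k <= l)%N).
Hypotheses (x2 : 2 <= x) (lx : l%:R <= x) (qx : (2 / q) ^+ k <= x).
Hypothesis xn : x ^+ 40 <= n.

Let ccn (A : {set {set V}}) : R := (capped_cover l (l ^ 6) A)%:R.
Let P := vpairs V.

Let x1 : 1 <= x. Proof. by have := x2; lra. Qed.
Let x0 : 0 < x. Proof. by have := x2; lra. Qed.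
Let kx : k%:R <= x. Proof. by apply: le_trans lx; rewrite ler_nat. Qed.

Let xn24 : 80 * x ^+ 24 <= n.
Proof.
apply: le_trans xn; rewrite (_ : 40 = 16 + 24)%N // exprD.
rewrite ler_wpM2r ?exprn_ge0 ?(ltW x0) //.
apply: le_trans (_ : 2 ^+ 16 <= _); last by rewrite lerXn2r ?nnegrE ?(ltW x0).
by rewrite -natrX ler_nat.
Qed.

Let xge i : (i <= 24)%N -> x ^+ i <= x ^+ 24.
Proof. by move=> i24; apply: ler_weXn2l. Qed.

Let n0 : 0 < n.
Proof. by apply: lt_le_trans xn; rewrite exprn_gt0. Qed.

Let kn : (2 <= k <= #|V|)%N.
Proof.
rewrite k2 -(ler_nat R) /=; apply: le_trans kx _.
have := xge (isT : 1 <= 24)%N; rewrite expr1 => H.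
by apply: le_trans H _; apply: le_trans xn24; rewrite ler_peMl ?exprn_ge0 ?(ltW x0) //; lra.
Qed.

Let N0 : 0 < 'C(#|V|, 2)%:R :> R.
Proof. by rewrite ltr0n bin_gt0; case/andP: kn; exact: leq_trans. Qed.

Let qVx : q^-1 <= x.
Proof.
have h : 1 <= 2 / q by rewrite ler_pdivlMr // mul1r; have := q1; lra.
apply: le_trans qx; apply: le_trans (ler_weXn2l h (ltnW k2)).
by rewrite expr1 ler_peMl ?invr_ge0 ?(ltW q0) //; lra.
Qed.

Let ep := edge_prob R V k.

Let ep_le : ep <= (k%:R / n) ^+ 2.
Proof.
rewrite /ep /edge_prob !bin2_natr -/n.
have n1 : 1 < n by rewrite /n ltr1n; case/andP: kn; exact: leq_trans.
have kn' : k%:R <= n by rewrite ler_nat; case/andP: kn.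
have k0 : 0 <= k%:R :> R by [].
rewrite ler_pdivrMr; last by nra.
rewrite (_ : (k%:R / n) ^+ 2 * (n * (n - 1) / 2) =
  k%:R * (k%:R * (1 - n^-1)) / 2); last first.
  by field; rewrite gt_eqF.
rewrite !ler_wpM2r ?invr_ge0 // ler_wpM2l //.
rewrite mulrBr mulr1 lerD2l lerN2 ler_pdivrMr // mul1r //.
Qed.

Let ep_ge : k%:R ^+ 2 / (2 * n ^+ 2) <= ep.
Proof.
rewrite /ep /edge_prob !bin2_natr -/n.
have n1 : 1 < n by rewrite /n ltr1n; case/andP: kn; exact: leq_trans.
have kk : 2 <= k%:R :> R by rewrite ler_nat.
rewrite ler_pdivlMr; last by nra.
rewrite (_ : k%:R ^+ 2 / (2 * n ^+ 2) * (n * (n - 1) / 2) =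
  k%:R * (k%:R * (1 - n^-1) / 2) / 2); last first.
  by field; rewrite gt_eqF.
rewrite !ler_wpM2r ?invr_ge0 // ler_wpM2l //.
have nV : 0 <= n^-1 by rewrite invr_ge0 ltW.
nra.
Qed.

Let u := n^-1.
Let u0 : 0 < u. Proof. by rewrite invr_gt0. Qed.
Let xu i : (i <= 24)%N -> x ^+ i * u <= 80^-1.
Proof.
move=> /xge xi; rewrite ler_pdivrMr //.
by have := xn24; lra.
Qed.

Let ep_u : ep <= x ^+ 2 * u ^+ 2.
Proof.
apply: le_trans ep_le _; rewrite exprMn ler_wpM2r ?sqr_ge0 //.
by rewrite lerXn2r ?nnegrE ?(ltW x0).
Qed.

Let ep0 : 0 < ep.
Proof.
apply: lt_le_trans ep_ge; rewrite divr_gt0 ?[0 < 2 * _]mulr_gt0 ?exprn_gt0 //.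
by rewrite ltr0n ltnW.
Qed.

Let u1 : u <= 80^-1. Proof. by have := xu (leq0n _); rewrite expr0 mul1r. Qed.

Let ep_half : ep <= 2^-1.
Proof.
apply: le_trans ep_u _; rewrite expr2 mulrA.
have h := xu (isT : 2 <= 24)%N.
have h0 : 0 <= x ^+ 2 * u by rewrite mulr_ge0 ?sqr_ge0 ?(ltW u0).
have := ler_pM h0 (ltW u0) h u1; lra.
Qed.

Let a := ep / (1 - ep).

Let a_le : a <= 2 * (x ^+ 2 * u ^+ 2).
Proof.
apply: le_trans (_ : 2 * ep <= _); last by rewrite ler_wpM2l.
have := ep_half; have := ep0 => e0 eh.
by rewrite ler_pdivrMr ?subr_gt0; nra.
Qed.

Let a_ge : ep <= a.
Proof.
have := ep_half; have := ep0 => e0 eh.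
by rewrite ler_pdivlMr ?subr_gt0; nra.
Qed.

Let d := q - planted_rate V k q.

Let dE : d = (1 - q) * a. Proof. by rewrite /d /planted_rate -/ep -/a; ring. Qed.

Let d_ge : 0 <= d.
Proof. by rewrite dE mulr_ge0 ?subr_ge0 ?(ltW q1) // (le_trans (ltW ep0) a_ge). Qed.

Let dq_le : d / q <= 4^-1.
Proof.
apply: le_trans (_ : (2 * (x ^+ 2 * u ^+ 2)) * x <= _).
  apply: ler_pM => //; first by rewrite invr_ge0 ltW.
  rewrite dE; apply: le_trans a_le; rewrite ler_piMl //.
    by rewrite (le_trans (ltW ep0) a_ge).
  by have := q0; lra.
have h := xu (isT : 3 <= 24)%N.
have h0 : 0 <= x ^+ 3 * u by rewrite mulr_ge0 ?exprn_ge0 ?(ltW x0) ?(ltW u0).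
have := ler_pM h0 (ltW u0) h u1.
rewrite (_ : x ^+ 3 * u * u = x ^+ 2 * u ^+ 2 * x); last by ring.
lra.
Qed.

Let w := expR (2 * d / q) / q.

Let w_ge : 1 <= w.
Proof.
rewrite ler_pdivlMr // mul1r (le_trans (ltW q1)) //.
by rewrite -[leLHS]expR0 ler_expR divr_ge0 ?mulr_ge0 ?(ltW q0).
Qed.

Let w_le : w <= 2 / q.
Proof.
rewrite ler_wpM2r ?invr_ge0 ?(ltW q0) //.
have h : 0 <= 2 * d / q <= 2^-1.
  by rewrite divr_ge0 ?mulr_ge0 ?(ltW q0) //=; have := dq_le; lra.
by apply: le_trans (expR_le1D2 h) _; have := dq_le; lra.
Qed.

Let X := 2 * (20 * x ^+ 8 * u ^+ 4 + x ^+ 7 * u ^+ 3).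

Let chi_le :
  (\sum_(K in ksets V k) \sum_(L in ksets V k)
     \prod_(e in P) chi_factor q (planted_law k q K) (planted_law k q L) e)
   / #|ksets V k|%:R ^+ 2 <= 1 + X.
Proof.
have h2 := xu (isT : 2 <= 24)%N.
have h8 := xu (isT : 8 <= 24)%N.
have h7 := xu (isT : 7 <= 24)%N.
have uu0 := ltW u0.
have x8 : 0 <= x ^+ 8 * u by rewrite mulr_ge0 ?exprn_ge0 ?(ltW x0) ?(ltW u0).
have x7 : 0 <= x ^+ 7 * u by rewrite mulr_ge0 ?exprn_ge0 ?(ltW x0) ?(ltW u0).
have u21 : u ^+ 2 <= 80^-1 ^+ 2 by rewrite lerXn2r ?nnegrE ?invr_ge0.
have u31 : u ^+ 3 <= 80^-1 ^+ 3 by rewrite lerXn2r ?nnegrE ?invr_ge0.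
apply: le_trans (chi_planted_avg (x := x) q0 q1 _ _ kn N0 _ w_ge _ _ _ _) _ => //.
- by have := dq_le; rewrite -/d ler_pdivrMr //; have := q0; lra.
- by have := ep_half; rewrite -/ep; lra.
- by apply: le_trans qx; apply: lerXn2r w_le; rewrite nnegrE divr_ge0 ?expR_ge0 ?(ltW q0).
- apply: le_trans qx; rewrite lerXn2r ?nnegrE ?divr_ge0 ?(ltW q0) //.
  by rewrite ler_pdivlMr // ler_piMr // ltW.
- have h := xge (isT : 2 <= 24)%N; rewrite -/n.
  apply: le_trans (_ : x ^+ 2 <= _); first by rewrite expr2 ler_wpM2r // ltW.
  apply: le_trans h _; apply: le_trans xn24; rewrite ler_peMl ?exprn_ge0 ?(ltW x0) //; lra.
- by have := dq_le; rewrite -/d; lra.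
rewrite -/n -/u -/ep -/a.
set z := _ + _.
have z0 : 0 <= z.
  apply: addr_ge0.
    apply: mulr_ge0; last by rewrite invr_ge0 exprn_ge0 ?(ltW q0).
    by apply: mulr_ge0; [exact: mulr_ge0 | exact: sqr_ge0].
  by rewrite mulr_ge0 ?exprn_ge0 ?mulr_ge0 ?(ltW x0) ?(ltW u0).
have zX : 2 * z <= X.
  rewrite /X ler_wpM2l // lerD //.
    rewrite -exprVn (_ : 20 * x ^+ 8 * u ^+ 4 =
      5 * x ^+ 2 * (2 * (x ^+ 2 * u ^+ 2)) ^+ 2 * x ^+ 2); last by ring.
    have a0 : 0 <= a := le_trans (ltW ep0) a_ge.
    have Bx : 'C(k, 2)%:R <= x ^+ 2.
      rewrite bin2_natr; have := kx; have : 2 <= k%:R :> R by rewrite ler_nat.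
      nra.
    have a2 := sqr_ge0 a.
    apply: ler_pM.
    - by apply: mulr_ge0 a2; exact: mulr_ge0.
    - by rewrite exprn_ge0 // invr_ge0 ltW.
    - apply: ler_pM => //; first exact: mulr_ge0.
        by rewrite ler_wpM2l.
      by apply: lerXn2r a_le; rewrite nnegrE // ?mulr_ge0 ?exprn_ge0 ?(ltW x0) ?(ltW u0).
    by apply: lerXn2r qVx; rewrite nnegrE ?invr_ge0 ?(ltW q0) ?(ltW x0).
  rewrite (_ : x ^+ 7 * u ^+ 3 = x * (x * x * u) ^+ 3); last by ring.
  rewrite ler_wpM2l ?(ltW x0) // lerXn2r ?nnegrE ?mulr_ge0 ?(ltW x0) //.
  by rewrite !ler_wpM2r ?(ltW x0).
have X1 : X <= 1.
  have H1 := ler_pM x8 (exprn_ge0 3 uu0) h8 u31.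
  have H2 := ler_pM x7 (exprn_ge0 2 uu0) h7 u21.
  have -> : X = 40 * (x ^+ 8 * u * u ^+ 3) + 2 * (x ^+ 7 * u * u ^+ 2) by rewrite /X; ring.
  lra.
apply: le_trans (expR_le1D2 _) _; first by rewrite z0; lra.
by rewrite lerD2l.
Qed.

Lemma planted_rate_ge0 : 0 <= planted_rate V k q.
Proof.
by have := dq_le; rewrite ler_pdivrMr // /d; have := q0; lra.
Qed.

Lemma planted_rate_le :
  planted_rate V k q <= q - (1 - q) * (k%:R ^+ 2 / (2 * n ^+ 2)).
Proof.
have -> : planted_rate V k q = q - d by rewrite /d; ring.
rewrite lerD2l lerN2 dE ler_wpM2l ?subr_ge0 ?(ltW q1) //.
exact: le_trans ep_ge a_ge.
Qed.

(** In W * X <= 1 below, W = n^2 x^16 bounds the variance and X, of order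
    x^8 / n^4 + x^7 / n^3, bounds chi^2; the hypothesis x^40 <= n leaves ample
    room. *)
Lemma planting_step :
  Ex P (fun=> q) ccn <= Ex P (fun=> planted_rate V k q) ccn + 3.
Proof.
have r1 : planted_rate V k q <= 1.
  by have := d_ge; rewrite /d; have := q1; lra.
have q01 (e : {set V}) : 0 <= q <= 1 by rewrite !ltW.
have r01 (e : {set V}) : 0 <= planted_rate V k q <= 1.
  by rewrite planted_rate_ge0.
have l0 : (0 < l)%N by apply: leq_trans kl; apply: leq_trans k2.
set r := planted_rate V k q in r01 *.
pose W := n ^+ 2 * (x ^+ 8) ^+ 2.
have W0 : 0 < W by rewrite mulr_gt0 ?exprn_gt0.
have VW : Var P (fun=> q) ccn <= W.
  apply: le_trans (Var_lipschitz (c := x ^+ 8) q01 _) _.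
    move=> e A eP _; apply: le_trans (capped_cover_lipschitz R A eP _) _.
      by rewrite muln_gt0 !expn_gt0 l0.
    by rewrite -expnD natrX lerXn2r ?nnegrE ?(ltW x0).
  rewrite ler_wpM2r ?sqr_ge0 // card_vpairs bin2_natr -/n.
  by clear q01 r01; have := n0; nra.
have mix := Ex_mixture_ge q0 q1 (I := {set V}) (J := ksets V k) _ W0 VW chi_le.
have J0 : (0 < #|ksets V k|)%N by rewrite card_ksets bin_gt0; case/andP: kn.
have m0 : 0 < #|ksets V k|%:R :> R by rewrite ltr0n.
apply: le_trans (mix J0) _.
have WX : W * X <= 1.
  have h24 := xu (isT : 24 <= 24)%N.
  have h23 := xu (isT : 23 <= 24)%N.
  have h0 : 0 <= x ^+ 24 * u by rewrite mulr_ge0 ?exprn_ge0 ?(ltW x0) ?(ltW u0).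
  have := ler_pM h0 (ltW u0) h24 u1.
  have nu : n * u = 1 by rewrite divff // gt_eqF.
  have -> : W * X = 40 * (x ^+ 24 * u * u) * (n * u) ^+ 2 + 2 * (x ^+ 23 * u) * (n * u) ^+ 2.
    by rewrite /W /X; ring.
  by clear q01 r01; rewrite nu expr1n !mulr1; lra.
have HL : (\sum_(K in ksets V k) Ex P (planted_law k q K) ccn) / #|ksets V k|%:R
   <= Ex P (fun=> r) ccn + 2.
  rewrite ler_pdivrMr //.
  rewrite (eq_bigr (fun K => Ex P (fun=> r) (fun A => ccn (A :|: pairs K)))); last first.
    by move=> K _; rewrite (Ex_setU _ _ (pairs_subset K)).
  rewrite -Ex_sum -(Ex_cst P (fun=> r) 2) -ExD mulrC -ExZ.
  apply: ler_Ex => // A AP; exact: capped_cover_plant_avg.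
by clear q01 r01; apply: le_trans (lerD HL (lexx _)) _; lra.
Qed.

End Step.

(** * Descent on the density *)

Section Descent.
Variables (R : realType) (V : finType) (L p : R).
Let n : R := #|V|%:R.
Hypotheses (Ln : expR L = n) (Lbig : 480 ^+ 2 <= L) (p0 : 0 < p) (p1 : p < 1).

Let l := Num.truncn L.
(* x = n^(1/40) plays the part of n^(o(1)) in all error terms. *)
Let x := expR (L / 40).
Let ccn (A : {set {set V}}) : R := (capped_cover l (l ^ 6) A)%:R.
Let P := vpairs V.

Let L0 : 0 < L. Proof. by apply: lt_le_trans Lbig; rewrite exprn_gt0. Qed.

Let n0 : 0 < n. Proof. by rewrite -Ln expR_gt0. Qed.

Let Lx : L <= x. Proof. exact: exp_frac_ge L0 Lbig. Qed.

Let xn : x ^+ 40 = n.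
Proof. by rewrite /x -expRM_natl -Ln; congr expR; field. Qed.

Let lL : l%:R <= L. Proof. by rewrite truncn_le ltW. Qed.

(** The exponent 1/4 keeps (2 / q) ^+ ksize q below x, because ln (2 / q) is at
    most 6 / q^(1/4), and makes ksize q ^+ 2 at least a multiple of
    sqrt q * L ^+ 2, which is what the potential sqrt q needs. *)
Let ksize (q : R) := Num.truncn (Num.sqrt (Num.sqrt q) * L / 240).

Let ksizeP (q : R) : L ^- 2 <= q -> q < 1 ->
  [/\ (2 <= ksize q)%N, (ksize q <= l)%N, (2 / q) ^+ ksize q <= x
    & Num.sqrt q * (L / 480) ^+ 2 <= (ksize q)%:R ^+ 2].
Proof.
move=> qL q1; have q0 : 0 < q by apply: lt_le_trans qL; rewrite invr_gt0 exprn_gt0.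
rewrite /ksize; set s2 := Num.sqrt q; set s := Num.sqrt s2.
have s20 : 0 < s2 by rewrite sqrtr_gt0.
have s0 : 0 < s by rewrite sqrtr_gt0.
have s2E : s ^+ 2 = s2 by rewrite sqr_sqrtr // ltW.
have qE : s2 ^+ 2 = q by rewrite sqr_sqrtr // ltW.
have s2L : 1 <= s2 * L.
  rewrite -(@ler_pXn2r _ 2) ?nnegrE ?mulr_ge0 ?(ltW s20) ?(ltW L0) // expr1n exprMn qE.
  by rewrite -ler_pdivrMr ?exprn_gt0 // div1r.
(* This makes s * L / 240 at least 2, so rounding down at most halves it. *)
have sL : 480 <= s * L.
  rewrite -(@ler_pXn2r _ 2) ?nnegrE ?mulr_ge0 ?(ltW s0) ?(ltW L0) // exprMn s2E.
  apply: le_trans Lbig _; rewrite expr2 mulrA ler_peMl // ltW //.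
have s1 : s <= 1.
  by rewrite -sqrtr1 ler_wsqrtr // -sqrtr1 ler_wsqrtr // ltW.
have y2 : 2 <= s * L / 240 by lra.
have y0 : 0 <= s * L / 240 by lra.
have /andP[k_le k_gt] := truncn_itv y0.
set k := Num.truncn _ in k_le k_gt *; rewrite -(natr1 k) in k_gt.
have k_ge : s * L / 480 <= k%:R by lra.
split.
- by rewrite truncn_ge_nat.
- rewrite /l truncn_ge_nat ?(ltW L0) // (le_trans k_le) //.
  have : s * L <= 1 * L by rewrite ler_wpM2r // ltW.
  by have := L0; lra.
- have -> : q = s ^+ 4 by rewrite -qE -s2E -exprM.
  apply: le_trans (_ : expR (6 / s) ^+ k <= _).
    apply: lerXn2r; rewrite ?nnegrE ?expR_ge0 ?divr_ge0 ?exprn_ge0 ?(ltW s0) //.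
    exact: inv_le_expR.
  rewrite -expRM_natl ler_expR.
  apply: le_trans (ler_wpM2r _ k_le) _; first by rewrite divr_ge0 // ltW.
  by rewrite le_eqVlt; apply/orP; left; apply/eqP; field; rewrite gt_eqF.
rewrite -s2E -exprMn mulrA; apply: lerXn2r => //; rewrite nnegrE //.
by rewrite divr_ge0 // mulr_ge0 // ltW.
Qed.

Let C := 12 * 480 ^+ 2 / (1 - p).

Let nL : 0 < n ^+ 2 / L ^+ 2. Proof. by rewrite divr_gt0 ?exprn_gt0. Qed.

Let bound_small (q : R) : 0 <= q -> q <= L ^- 2 ->
  Ex P (fun=> q) ccn <= n ^+ 2 / L ^+ 2.
Proof.
move=> q0 qL; have q1 : q <= 1.
  apply: le_trans qL _; rewrite invf_le1 ?exprn_gt0 // exprn_ege1 //.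
  by have := Lbig; rewrite expr2; lra.
apply: le_trans (_ : Ex P (fun=> q) (fun A => #|A|%:R) <= _).
  apply: ler_Ex => [e|A _]; first by rewrite q0 q1.
  by rewrite /ccn ler_nat capped_cover_le.
rewrite Ex_card sumr_const -[leLHS]mulr_natl card_vpairs.
by apply: ler_pM => //; apply: binS2_le.
Qed.

(** A step costs 3 and lowers q by at least (1 - p) k^2 / (2 n^2), hence sqrt q
    by at least (1 - p) (L / 480)^2 / (4 n^2); the constant C makes the
    potential n^2 / L^2 * C * sqrt q pay for it.  The induction on m is on the
    number of steps left, since q decreases by (1 - p) / n^2 or more. *)
Let descent (m : nat) (q : R) : 0 <= q -> q <= p ->
  q <= L ^- 2 + m%:R * ((1 - p) / n ^+ 2) ->
  Ex P (fun=> q) ccn <= n ^+ 2 / L ^+ 2 * (1 + C * Num.sqrt q).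
Proof.
have p1' : 0 < 1 - p by rewrite subr_gt0.
have C0 : 0 < C by rewrite divr_gt0 // mulr_gt0 // exprn_gt0.
have small r : 0 <= r -> r <= L ^- 2 ->
    Ex P (fun=> r) ccn <= n ^+ 2 / L ^+ 2 * (1 + C * Num.sqrt r).
  move=> r0 rL; apply: le_trans (bound_small r0 rL) _.
  by rewrite ler_peMr ?(ltW nL) // lerDl mulr_ge0 ?sqrtr_ge0 // ltW.
elim: m q => [|m IH] q q0 qp qm.
  by apply: small => //; rewrite mul0r addr0 in qm.
have [qL|qL] := leP q (L ^- 2); first exact: small.
have q1 : q < 1 by apply: le_lt_trans p1.
have qpos : 0 < q by apply: lt_trans qL; rewrite invr_gt0 exprn_gt0.
have [k2 kl kx kq] := ksizeP (ltW qL) q1.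
set k := ksize q in k2 kl kx kq.
have x2 : 2 <= x by have := Lbig; have := Lx; rewrite expr2; lra.
have lx : l%:R <= x by apply: le_trans Lx.
have xn' : x ^+ 40 <= n by rewrite xn.
have step := planting_step qpos q1 k2 kl x2 lx kx xn'.
have r0 := planted_rate_ge0 qpos q1 k2 kl x2 lx kx xn'.
have rle := planted_rate_le q1 k2 kl x2 lx xn'.
set r := planted_rate V k q in step r0 rle.
have kk : 4 <= k%:R ^+ 2 :> R.
  by rewrite -natrX ler_nat (@leq_sqr 2).
have n2 : 0 < n ^+ 2 by rewrite exprn_gt0.
have qr : (1 - p) * (k%:R ^+ 2 / (2 * n ^+ 2)) <= q - r.
  have : (1 - p) * (k%:R ^+ 2 / (2 * n ^+ 2)) <= (1 - q) * (k%:R ^+ 2 / (2 * n ^+ 2)).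
    rewrite ler_wpM2r ?divr_ge0 ?mulr_ge0 ?sqr_ge0 ?(ltW n2) //; lra.
  by move: rle; rewrite -/n; lra.
have rq : r <= q.
  rewrite -subr_ge0; apply: le_trans qr.
  by rewrite mulr_ge0 ?(ltW p1') // divr_ge0 ?mulr_ge0 ?sqr_ge0 ?(ltW n2).
have rm : r <= L ^- 2 + m%:R * ((1 - p) / n ^+ 2).
  have : (1 - p) / n ^+ 2 <= q - r.
    apply: le_trans qr; rewrite ler_wpM2l ?(ltW p1') //.
    have -> : k%:R ^+ 2 / (2 * n ^+ 2) = k%:R ^+ 2 / 2 * n ^- 2.
      by field; rewrite gt_eqF.
    by rewrite ler_peMl ?invr_ge0 ?(ltW n2) // ler_pdivlMr // mul1r; lra.
  by move: qm; rewrite -natr1 mulrDl mul1r; lra.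
have := IH r r0 (le_trans rq qp) rm => {}IH.
apply: le_trans step _; apply: le_trans (lerD IH (lexx _)) _.
set s := Num.sqrt q in kq *; set t := Num.sqrt r.
have s0 : 0 < s by rewrite sqrtr_gt0.
have t0 : 0 <= t by apply: sqrtr_ge0.
have sE : s ^+ 2 = q by rewrite sqr_sqrtr.
have tE : t ^+ 2 = r by rewrite sqr_sqrtr.
have ts : t <= s by apply: ler_wsqrtr.
have st : q - r <= (s - t) * (2 * s) by rewrite -sE -tE; nra.
have key : (1 - p) * ((L / 480) ^+ 2 / (4 * n ^+ 2)) <= s - t.
  rewrite -(@ler_pM2r _ (2 * s)) ?mulr_gt0 //; apply: le_trans st.
  apply: le_trans qr.
  have -> : (1 - p) * ((L / 480) ^+ 2 / (4 * n ^+ 2)) * (2 * s) =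
    (1 - p) * (s * (L / 480) ^+ 2 / (2 * n ^+ 2)) by field; rewrite gt_eqF.
  rewrite ler_wpM2l ?(ltW p1') // ler_wpM2r // invr_ge0 mulr_ge0 // ltW //.
have H3 : 3 <= n ^+ 2 / L ^+ 2 * C * (s - t).
  apply: le_trans (_ : n ^+ 2 / L ^+ 2 * C *
      ((1 - p) * ((L / 480) ^+ 2 / (4 * n ^+ 2))) <= _).
    rewrite le_eqVlt; apply/orP; left; apply/eqP; rewrite /C; field.
    by rewrite !gt_eqF.
  by rewrite ler_wpM2l // mulr_ge0 ?(ltW nL) ?(ltW C0).
have -> : n ^+ 2 / L ^+ 2 * (1 + C * s) = n ^+ 2 / L ^+ 2 * (1 + C * t) +
   n ^+ 2 / L ^+ 2 * C * (s - t) by ring.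
by rewrite lerD2l.
Qed.

Lemma Ex_capped_cover_le :
  Ex P (fun=> p) ccn <= (1 + C) * (n ^+ 2 / L ^+ 2).
Proof.
have p1' : 0 < 1 - p by rewrite subr_gt0.
have C0 : 0 < C by rewrite divr_gt0 // mulr_gt0 // exprn_gt0.
have n2 : 0 < n ^+ 2 by rewrite exprn_gt0.
pose m := (Num.truncn (n ^+ 2 / (1 - p))).+1.
apply: le_trans (descent (m := m) (ltW p0) (lexx _) _) _.
  apply: le_trans (ltW p1) _; apply: le_trans (_ : m%:R * ((1 - p) / n ^+ 2) <= _).
    rewrite -ler_pdivrMr ?divr_gt0 // div1r invf_div.
    have h : 0 <= n ^+ 2 / (1 - p) by rewrite divr_ge0 // ltW.
    by have /andP[_ /ltW] := truncn_itv h.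
  by rewrite lerDr invr_ge0 sqr_ge0.
rewrite [leRHS]mulrC ler_wpM2l ?(ltW nL) // lerD2l ler_piMr ?(ltW C0) //.
by rewrite -sqrtr1 ler_wsqrtr // ltW.
Qed.

(** The Lipschitz constant l ^ 6 * l ^ 2 is at most x ^+ 8. *)
Lemma Var_capped_cover_le :
  Var P (fun=> p) ccn <= n ^+ 2 * (x ^+ 8) ^+ 2.
Proof.
have l0 : (0 < l)%N.
  by rewrite /l truncn_ge_nat ?(ltW L0) //; have := Lbig; rewrite expr2; lra.
apply: le_trans (Var_lipschitz (c := x ^+ 8) _ _) _.
- by move=> e; rewrite !ltW.
- move=> e A eP _; apply: le_trans (capped_cover_lipschitz R A eP _) _.
    by rewrite muln_gt0 !expn_gt0 l0.
  rewrite -expnD natrX lerXn2r ?nnegrE ?expR_ge0 //.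
  exact: le_trans lL Lx.
by rewrite ler_wpM2r ?sqr_ge0 // card_vpairs binS2_le.
Qed.

End Descent.

(** * Random graphs as random edge sets, and the lower bound *)

Section Transfer.
Variables (R : realFieldType) (n : nat) (p : R).
Hypotheses (p0 : 0 <= p) (p1 : p <= 1).
Let P := vpairs 'I_n.

Lemma Ex_edges (g : {set {set 'I_n}} -> R) :
  \sum_G Gnp_mass p G * g (edges G) = Ex P (fun=> p) g.
Proof.
rewrite /Ex (reindex_omap (@edges 'I_n) insub) /=; last first.
  by move=> A AP; rewrite insubT.
apply: eq_big => [G|G _]; last by [].
by have GP : edges G \subset P by [apply: (valP G)]; rewrite GP valK eqxx.
Qed.

Let mass_ge0 (G : sgraph 'I_n) : 0 <= Gnp_mass p G.
Proof. by apply: prodr_ge0 => e _; case: ifP => _ //; rewrite subr_ge0. Qed.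

Lemma Gnp_prob_le1 (E : pred (sgraph 'I_n)) : Gnp_prob p E <= 1.
Proof.
rewrite -(Gnp_probT n p) /Gnp_prob [leRHS](bigID E) /= lerDl.
by apply: sumr_ge0.
Qed.

(** A union bound: g is meant to be a sum of indicators of bad events that
    together cover the complement of E. *)
Lemma Gnp_prob_ge (E : pred (sgraph 'I_n)) (g : {set {set 'I_n}} -> R) :
  (forall G, 1 - g (edges G) <= (E G)%:R) -> 1 - Ex P (fun=> p) g <= Gnp_prob p E.
Proof.
move=> gE; rewrite -Ex_edges -(Gnp_probT n p) -sumrB /Gnp_prob [leRHS]big_mkcond.
apply: ler_sum => G _; rewrite -[X in X - _]mulr1 -mulrBr.
apply: le_trans (ler_wpM2l (mass_ge0 G) (gE G)) _.
by case: (E G); rewrite ?mulr1 ?mulr0.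
Qed.

Lemma Ex_subset (S : {set {set 'I_n}}) : S \subset P ->
  Ex P (fun=> p) (fun A => (S \subset A)%:R) = p ^+ #|S|.
Proof.
move=> SP; rewrite -Ex_edges -(Gnp_prob_edges p SP) /Gnp_prob [RHS]big_mkcond.
by apply: eq_bigr => G _; case: ifP => _; rewrite ?mulr1 ?mulr0.
Qed.

End Transfer.

(** Without cliques of size m every clique of a cover has fewer than m vertices,
    since cliques are closed under taking subsets. *)
Lemma card_edges_le (V : finType) (G : sgraph V) (m : nat) :
  (forall K, K \in ksets V m -> ~~ (pairs K \subset edges G)) ->
  (#|edges G| <= theta1 G * m ^ 2)%N.
Proof.
move=> noK; have [[F /andP[/forall_inP FK /forall_inP Fe] <-] _] := theta1P G.
have small K : K \in F -> (#|K| <= m)%N.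
  move=> KF; rewrite leqNgt; apply/negP => mK.
  have [J sJK cJ] : exists2 J : {set V}, J \subset K & #|J| = m.
    have : (0 < #|[set J : {set V} | J \subset K & #|J| == m]|)%N.
      by rewrite cards_draws bin_gt0 ltnW.
    by case/card_gt0P => J; rewrite inE => /andP[sJ /eqP cJ]; exists J.
  have := noK J; rewrite inE cJ eqxx => /(_ isT) /negP; apply.
  apply/subsetP => e; rewrite inE => /andP[eJ /cards2P[u [v [uv eE]]]].
  have /forall_inP/(_ u) := FK K KF.
  have uvK z : z \in e -> z \in K.
    by move=> ze; apply: (subsetP sJK); apply: (subsetP eJ).
  rewrite uvK ?eE ?set21 // => /(_ isT)/forall_inP/(_ v).
  by rewrite uvK ?eE ?set22 // => /(_ isT)/implyP; apply.
have sU : edges G \subset \bigcup_(K in F) pairs K.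
  apply/subsetP => e eG; have /exists_inP[K KF eK] := Fe e eG.
  apply/bigcupP; exists K => //; rewrite inE eK /=.
  have /subsetP/(_ e eG) : edges G \subset vpairs V by apply: (valP G).
  by rewrite inE.
apply: leq_trans (subset_leq_card sU) _.
apply: leq_trans (card_bigcup_le _ _) _.
by rewrite -sum_nat_const; apply: leq_sum => K /small; apply: card_pairs_le.
Qed.

Section FirstMoment.
Variables (R : realType) (n : nat) (p : R).
Hypotheses (p0 : 0 < p) (p1 : p < 1) (n0 : (0 < n)%N).

(** At most n^m candidates, each a clique with probability
    (p^(m-1))^(m/2) <= n^(-2m). *)
Lemma Ex_cliques_le (m : nat) : (0 < m)%N -> p ^+ m.-1 <= n%:R ^- 4 ->
  Ex (vpairs 'I_n) (fun=> p)
    (fun A => \sum_(K in ksets 'I_n m) (pairs K \subset A)%:R) <= n%:R^-1.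
Proof.
move=> m0 pm; rewrite Ex_sum.
have n1 : 1 <= n%:R :> R by rewrite ler1n.
rewrite (eq_bigr (fun=> p ^+ 'C(m, 2))); last first.
  move=> K; rewrite inE => /eqP cK.
  by rewrite Ex_subset ?pairs_subset // card_pairs cK.
rewrite sumr_const -[leLHS]mulr_natl card_ksets card_ord.
have pC : p ^+ 'C(m, 2) <= n%:R ^- (2 * m).
  rewrite -(@ler_pXn2r _ 2) ?nnegrE ?invr_ge0 ?exprn_ge0 ?(ltW p0) //.
  rewrite -exprVn -!exprM (_ : 'C(m, 2) * 2 = m.-1 * m)%N; last first.
    case: m m0 {pm} => // m _; have := mul_bin_diag m.+1 1.
    by rewrite /= bin1 => H; rewrite mulnC -H mulnC.
  rewrite exprM (_ : 2 * m * 2 = 4 * m)%N; last by lia.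
  rewrite [leRHS]exprM; apply: lerXn2r; last by rewrite exprVn.
    by rewrite nnegrE exprn_ge0 ?(ltW p0).
  by rewrite nnegrE exprn_ge0 ?invr_ge0.
have nC : 'C(n, m)%:R <= n%:R ^+ m :> R.
  rewrite -natrX ler_nat; elim: (m) (n) => [|j IH] i; first by rewrite bin0.
  apply: leq_trans (leq_pmull _ (ltn0Sn j)) _.
  rewrite -mul_bin_diag expnS leq_mul2l (leq_trans (IH _)) ?orbT //.
  by case: (j) => // j'; rewrite leq_exp2r ?leq_pred.
apply: le_trans (ler_pM _ _ nC pC) _; rewrite ?exprn_ge0 ?(ltW p0) //.
rewrite mul2n -addnn exprD invfM mulrA divff ?mul1r; last first.
  by rewrite expf_neq0 // pnatr_eq0 -lt0n.
by rewrite lef_pV2 ?posrE ?exprn_gt0 ?ltr0n // ler_eXnr.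
Qed.

End FirstMoment.

(** * Both bounds with explicit constants *)

Section Quantitative.
Variables (R : realType) (p : R).
Hypotheses (p0 : 0 < p) (p1 : p < 1).

(** Typically there are at least p n^2 / 8 edges, and no clique has
    (4 / - ln p + 2) ln n vertices. *)
Definition lower_const : R := p / (8 * (4 / - ln p + 2) ^+ 2).
(** The constant for the expectation of capped_cover, plus 1 for the deviation
    from it. *)
Definition upper_const : R := 2 + 12 * 480 ^+ 2 / (1 - p).

Let lam : R := - ln p.
Let lam0 : 0 < lam. Proof. by rewrite oppr_gt0 ln_lt0 // p0 p1. Qed.

Lemma lower_const_gt0 : 0 < lower_const.
Proof. by rewrite divr_gt0 // mulr_gt0 // exprn_gt0 // addr_gt0 // divr_gt0. Qed.

Lemma upper_const_gt0 : 0 < upper_const.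
Proof.
apply: addr_gt0 => //; apply: divr_gt0; last by rewrite subr_gt0.
by apply: mulr_gt0 => //; apply: exprn_gt0.
Qed.

Variable n : nat.
Let L : R := ln n%:R.
Hypotheses (n0 : (0 < n)%N) (Lbig : 480 ^+ 2 <= L).

Let nR : 0 < n%:R :> R. Proof. by rewrite ltr0n. Qed.
Let Ln : expR L = n%:R. Proof. by rewrite /L lnK // posrE. Qed.
Let L1 : 1 <= L. Proof. by have := Lbig; rewrite expr2; lra. Qed.
Let L0 : 0 < L. Proof. by have := L1; lra. Qed.
Let q01 (e : {set 'I_n}) : 0 <= p <= 1. Proof. by rewrite !ltW. Qed.

(* Large enough for p ^+ m.-1 <= n ^- 4, as p = exp (- lam). *)
Let m := (Num.truncn (4 * L / lam)).+2.

Let m_le : m%:R <= (4 / lam + 2) * L.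
Proof.
have h : 0 <= 4 * L / lam by rewrite divr_ge0 ?mulr_ge0 // ltW.
have /andP[k_le _] := truncn_itv h.
have -> : m%:R = (Num.truncn (4 * L / lam))%:R + 2 :> R by rewrite -natrD addn2.
rewrite [leRHS]mulrDl.
have -> : 4 / lam * L = 4 * L / lam by field; rewrite gt_eqF.
have := L1; lra.
Qed.

Let pm_le : p ^+ m.-1 <= n%:R ^- 4.
Proof.
have h : 0 <= 4 * L / lam by rewrite divr_ge0 ?mulr_ge0 // ltW.
have /andP[_ /ltW k_gt] := truncn_itv h.
have -> : p = expR (- lam) by rewrite /lam opprK lnK // posrE.
rewrite -Ln -[leLHS]expRM_natl -[X in X^-1]expRM_natl -expRN ler_expR.
rewrite mulrN lerN2 -ler_pdivrMr //=.
Qed.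

Let N : R := 'C(n, 2)%:R.
Let N_ge : n%:R ^+ 2 / 4 <= N.
Proof.
have n2 : 2 <= n%:R :> R.
  rewrite -Ln; apply: le_trans (expR_ge1Dx _); have := L1; lra.
rewrite /N bin2_natr; nra.
Qed.

Let P := vpairs 'I_n.
Let cardP : #|P| = 'C(n, 2). Proof. by rewrite card_vpairs card_ord. Qed.

Let size_deviates (A : {set {set 'I_n}}) := p * N / 2 <= `|#|A|%:R - p * N|.

Let Ex_size_deviates :
  Ex P (fun=> p) (fun A => (size_deviates A)%:R) <= 16 / p ^+ 2 / n%:R.
Proof.
have N0 : 0 < N by apply: lt_le_trans N_ge; rewrite divr_gt0 // exprn_gt0.
have EA : Ex P (fun=> p) (fun A => #|A|%:R) = p * N.
  by rewrite Ex_card sumr_const cardP -[LHS]mulr_natl mulrC.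
have := @chebyshev _ _ P (fun=> p) (fun A => #|A|%:R) (p * N / 2) q01.
rewrite EA => H; apply: le_trans (H _) _; first by rewrite divr_gt0 // mulr_gt0.
have V : Var P (fun=> p) (fun A => #|A|%:R) <= N.
  apply: le_trans (Var_lipschitz (c := 1) q01 _) _.
    move=> a A _ _; rewrite cardsU1 natrD addrK.
    by case: (a \notin A); rewrite ?normr1 ?normr0.
  by rewrite cardP expr1n mulr1.
apply: le_trans (ler_wpM2r _ V) _.
  by rewrite invr_ge0 exprn_ge0 // divr_ge0 // mulr_ge0 // ltW.
have -> : N / (p * N / 2) ^+ 2 = 4 / p ^+ 2 / N by field; rewrite !gt_eqF.
have -> : 16 / p ^+ 2 / n%:R = 4 / p ^+ 2 / (n%:R / 4).
  by field; rewrite !gt_eqF.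
rewrite ler_wpM2l ?divr_ge0 ?sqr_ge0 // lef_pV2 ?posrE ?divr_gt0 //.
apply: le_trans N_ge; apply: ler_wpM2r; first by rewrite invr_ge0.
by rewrite expr2 ler_peMl ?ler1n // ltW.
Qed.

Let ccn (A : {set {set 'I_n}}) : R :=
  (capped_cover (Num.truncn L) (Num.truncn L ^ 6) A)%:R.
Let mu := Ex P (fun=> p) ccn.
Let deviates A := n%:R ^+ 2 / L ^+ 2 <= `|ccn A - mu|.

Let Ln' : expR L = #|'I_n|%:R. Proof. by rewrite card_ord. Qed.

Let Ex_deviates :
  Ex P (fun=> p) (fun A => (deviates A)%:R) <= n%:R^-1.
Proof.
apply: le_trans (chebyshev _ _ q01 _) _.
  by rewrite divr_gt0 // exprn_gt0.
have := Var_capped_cover_le 'I_n Lbig p0 p1; rewrite card_ord -/P -/ccn => V.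
apply: le_trans (ler_wpM2r _ V) _; first by rewrite invr_ge0 sqr_ge0.
set x := expR (L / 40).
have Lx : L <= x := exp_frac_ge L0 Lbig.
have x1 : 1 <= x := le_trans L1 Lx.
have xn : x ^+ 20 <= n%:R.
  apply: le_trans (_ : x ^+ 40 <= _); first exact: ler_weXn2l.
  by rewrite /x -expRM_natl -Ln ler_expR le_eqVlt; apply/orP; left; apply/eqP; field.
have -> : n%:R ^+ 2 * x ^+ 8 ^+ 2 / (n%:R ^+ 2 / L ^+ 2) ^+ 2 =
   L ^+ 4 * x ^+ 16 / n%:R / n%:R by field; rewrite !gt_eqF.
rewrite -[leRHS]mul1r ler_wpM2r ?invr_ge0 ?(ltW nR) // ler_pdivrMr // mul1r.
apply: le_trans xn; rewrite (_ : 20 = 4 + 16)%N // exprD ler_wpM2r ?exprn_ge0 ?expR_ge0 //.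
by apply: lerXn2r Lx; rewrite nnegrE ?expR_ge0 // ltW.
Qed.

Let good (G : sgraph 'I_n) :=
  (lower_const * n%:R ^+ 2 / L ^+ 2 <= (theta1 G)%:R :> R) &&
  ((theta1 G)%:R <= upper_const * n%:R ^+ 2 / L ^+ 2 :> R).

Let many_cliques (A : {set {set 'I_n}}) : R :=
  \sum_(K in ksets 'I_n m) (pairs K \subset A)%:R.

Let goodP G :
  1 - (many_cliques (edges G) + ((size_deviates (edges G))%:R + (deviates (edges G))%:R))
  <= (good G)%:R.
Proof.
have mc0 : 0 <= many_cliques (edges G) by apply: sumr_ge0.
have b0 (b : bool) : 0 <= b%:R :> R by [].
have [gG|/negP bG] := boolP (good G).
  by rewrite lerBlDr lerDl !addr_ge0.
rewrite lerBlDr add0r.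
have [fe|/negP fe] := boolP (size_deviates _).
  by rewrite -[leLHS]add0r lerD // lerDl.
have [dev|/negP dev] := boolP (deviates _).
  by rewrite addrA -[leLHS]add0r lerD // addr_ge0.
have [/exists_inP[K Km Ke]|/exists_inPn noK] :=
    boolP [exists K in ksets 'I_n m, pairs K \subset edges G].
  rewrite -[leLHS]addr0 lerD ?addr_ge0 //.
  by rewrite /many_cliques (bigD1 K) //= Ke lerDl sumr_ge0.
case: bG; apply/andP; split.
  have := card_edges_le noK; rewrite -(ler_nat R) natrM natrX => H.
  have eG : p * N / 2 <= #|edges G|%:R.
    move/negP: fe; rewrite /size_deviates -ltNge ltr_norml => /andP[+ _].
    by lra.
  have m2 : m%:R ^+ 2 <= ((4 / lam + 2) * L) ^+ 2.
    by apply: lerXn2r m_le; rewrite nnegrE // mulr_ge0 ?(ltW L0) // addr_ge0 // divr_ge0 // ltW.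
  have c0 : 0 < 4 / lam + 2 by rewrite addr_gt0 // divr_gt0.
  rewrite /lower_const -/lam ler_pdivrMr ?exprn_gt0 //.
  rewrite mulrAC ler_pdivrMr ?mulr_gt0 ?exprn_gt0 //.
  have -> : (theta1 G)%:R * L ^+ 2 * (8 * (4 / lam + 2) ^+ 2) =
     8 * ((theta1 G)%:R * ((4 / lam + 2) * L) ^+ 2) by ring.
  have H2 : p * N / 2 <= (theta1 G)%:R * ((4 / lam + 2) * L) ^+ 2.
    by apply: le_trans eG _; apply: le_trans H _; rewrite ler_wpM2l.
  have := ler_wpM2l (ltW p0) N_ge; lra.
apply: le_trans (_ : ccn (edges G) <= _).
  by rewrite ler_nat theta1_le_capped.
have mu_le := Ex_capped_cover_le (V := 'I_n) Ln' Lbig p0 p1.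
rewrite card_ord -/P -/ccn -/mu in mu_le.
move/negP: dev; rewrite /deviates -ltNge ltr_norml => /andP[_ dev].
rewrite /upper_const -mulrA; set y := n%:R ^+ 2 / L ^+ 2 in mu_le dev *.
lra.
Qed.

Lemma Gnp_theta1_ge : 1 - (2 + 16 / p ^+ 2) / n%:R <= Gnp_prob p good.
Proof.
apply: le_trans (@Gnp_prob_ge _ _ _ (ltW p0) (ltW p1) good
  (fun A => many_cliques A + ((size_deviates A)%:R + (deviates A)%:R)) goodP).
rewrite lerD2l lerN2 !ExD.
have := Ex_cliques_le p0 p1 n0 (ltn0Sn _) pm_le; rewrite -/many_cliques -/P => H1.
apply: le_trans (lerD H1 (lerD Ex_size_deviates Ex_deviates)) _.
by rewrite le_eqVlt; apply/orP; left; apply/eqP; field; rewrite !gt_eqF.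
Qed.

End Quantitative.

From mathcomp Require Import all_classical all_reals all_analysis.
Import numFieldNormedType.Exports.
Local Open Scope classical_set_scope.
Local Open Scope ring_scope.

Theorem theorem1 (R : realType) (p : R) (hp0 : 0 < p) (hp1 : p < 1) :
  exists c1 c2 : R, [/\ 0 < c1, 0 < c2 &
    (fun n : nat => Gnp_prob p (fun G : sgraph 'I_n =>
       (c1 * n%:R ^+ 2 / ln n%:R ^+ 2 <= (theta1 G)%:R :> R) &&
       ((theta1 G)%:R <= c2 * n%:R ^+ 2 / ln n%:R ^+ 2 :> R)))
      @ \oo --> (1 : R)].
Proof.
exists (lower_const p), (upper_const p); split.
- exact: lower_const_gt0.
- exact: upper_const_gt0.
apply/cvgrPdist_le => eps eps0; near=> n.
have nL : expR (480 ^+ 2) <= n%:R :> R by near: n; apply: nbhs_infty_ger.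
have nD : (2 + 16 / p ^+ 2) / eps <= n%:R :> R by near: n; apply: nbhs_infty_ger.
have nR : 0 < n%:R :> R by apply: lt_le_trans nL; apply: expR_gt0.
have Lbig : 480 ^+ 2 <= ln n%:R :> R.
  by rewrite -ler_expR lnK ?posrE.
have n0 : (0 < n)%N by rewrite -(ltr0n R).
have H := Gnp_theta1_ge hp0 hp1 n0 Lbig.
have H1 := Gnp_prob_le1 (ltW hp0) (ltW hp1).
rewrite ger0_norm ?subr_ge0 //.
apply: le_trans (_ : (2 + 16 / p ^+ 2) / n%:R <= _); first by move: H; lra.
by rewrite ler_pdivrMr // [leRHS]mulrC -ler_pdivrMr.
Unshelve. all: by end_near.
Qed.
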